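(* Let $X$ be a quasi-reflexive Banach space, let $p\in(1,\infty)$ and let $q$ be the conjugate exponent of $p$ (i.e. $\frac1p+\frac1q=1$). Assume that $X$ admits an equivalent $p$-asymptotically uniformly smooth ($p$-AUS) norm and that $X^*$ admits an equivalent $q$-asymptotically uniformly smooth ($q$-AUS) norm. Then the family of Kalton interlaced graphs $([\mathbb{N}]^k,d_{\mathbb{K}}^k)_{k\in\mathbb{N}}$ does not equi-coarsely embed into the bidual $X^{**}$.
   Context: Quasi-reflexive: a Banach space is quasi-reflexive if the image of its canonical embedding into its bidual is of finite codimension in the bidual. Asymptotic uniform smoothness: for a Banach space $(X,\|\cdot\|)$ with unit sphere $S_X$ and $t\in[0,\infty)$, put $\overline{\rho}_X(t)=\sup_{x\in S_X}\inf_{Y}\sup_{y\in S_Y}(\|x+ty\|-1)$, where $Y$ runs through all closed subspaces of $X$ of finite codimension. For $p\in(1,\infty)$ the norm is $p$-AUS if there exists $c>0$ such that $\overline{\rho}_X(t)\le ct^p$ for all $t\in[0,\infty)$. An equivalent norm on $X^*$ is not required to be a dual norm. Kalton interlaced graphs: for $k\in\mathbb{N}$, $[\mathbb{N}]^k$ is the set of subsets of $\mathbb{N}$ of cardinality $k$, whose elements are listed in increasing order, $\overline{n}=(n_1,\dots,n_k)$ with $n_1<\dots<n_k$. Two distinct elements $\overline{m}\ne\overline{n}$ of $[\mathbb{N}]^k$ are adjacent if $n_1\le m_1\le n_2\le\dots\le n_k\le m_k$ or $m_1\le n_1\le m_2\le\dots\le m_k\le n_k$. The metric $d_{\mathbb{K}}^k$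 is the shortest path distance of this graph. Equi-coarse embedding: for a map $f:M\to N$ between metric spaces and $t\in[0,\infty)$, put $\rho_f(t)=\inf\{d_N(f(x),f(y)):d_M(x,y)\ge t\}$ and $\omega_f(t)=\sup\{d_N(f(x),f(y)):d_M(x,y)\le t\}$ (with $\inf\emptyset=\infty$, $\sup\emptyset=0$). A family $(M_i)_{i\in I}$ of metric spaces equi-coarsely embeds into a metric space $N$ if there exist maps $\rho,\omega:[0,\infty)\to[0,\infty)$ and maps $f_i:M_i\to N$ ($i\in I$) such that $\lim_{t\to\infty}\rho(t)=\infty$, $\omega(t)<\infty$ for every $t\in[0,\infty)$, and $\rho(t)\le\rho_{f_i}(t)$ and $\omega_{f_i}(t)\le\omega(t)$ for every $i\in I$ and $t\in[0,\infty)$. *)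

(* Defs.v *)
From HB Require Import structures.
From mathcomp Require Import all_boot all_order all_algebra.
From mathcomp Require Import all_classical all_reals all_analysis.

Set Implicit Arguments.
Unset Strict Implicit.
Unset Printing Implicit Defensive.

Import Order.TTheory GRing.Theory Num.Theory.
Import numFieldNormedType.Exports.

Local Open Scope classical_set_scope.
Local Open Scope ring_scope.

Section dual_lmodule.
Context (R : realType) (V : normedModType R).

Definition continuous_linear_form : {pred V -> R^o} :=
  [pred f : V -> R^o | `[< linear f /\ continuous f >]].

Record dual : Type :=
  Dual { dual_fun :> V -> R^o ; _ : dual_fun \in continuous_linear_form }.

HB.instance Definition _ := [isSub for dual_fun].
HB.instance Definition _ := [Choice of dual by <:].

Lemma continuous_linear_formP (f : V -> R^o) :
  reflect (linear f /\ continuous f) (f \in continuous_linear_form).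
Proof. exact: asboolP. Qed.

Lemma continuous_linear_form_submod : submod_closed continuous_linear_form.
Proof.
split.
  apply/continuous_linear_formP; split; last exact: cst_continuous.
  by move=> a u v; rewrite -[RHS]/(a *: 0 + 0) scaler0 addr0.
move=> a f g /continuous_linear_formP[fl fc] /continuous_linear_formP[gl gc].
apply/continuous_linear_formP; split.
  move=> b u v; rewrite !fctE/= fl gl !scalerDr !scalerA (mulrC a b).
  by rewrite !addrA; congr (_ + _); rewrite addrAC.
by move=> x; apply: cvgD; [apply: cvgZr; exact: fc|exact: gc].
Qed.

HB.instance Definition _ := GRing.isSubmodClosed.Build R (V -> R^o)
  continuous_linear_form continuous_linear_form_submod.
HB.instance Definition _ := [SubChoice_isSubLmodule of dual by <:].

Lemma dual_linear (f : dual) : linear f.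
Proof. by have /continuous_linear_formP[] := valP f. Qed.

Lemma dual_continuous (f : dual) : continuous f.
Proof. by have /continuous_linear_formP[] := valP f. Qed.

HB.instance Definition _ (f : dual) :=
  GRing.isLinear.Build R V R^o *:%R (dual_fun f) (dual_linear f).

Lemma dualP (f g : dual) : f =1 g -> f = g.
Proof. by move=> fg; apply/val_inj/funext. Qed.

Definition dual_norm (f : dual) : R :=
  sup [set `|f x| | x in [set x : V | `|x| <= 1]].

Lemma dual_bounded (f : dual) : exists2 C : R, 0 <= C &
  forall x, `|f x| <= C * `|x|.
Proof.
have /linear_boundedP[C [Cr fC]] : bounded_near f (nbhs (0 : V)).
  exact/continuous_linear_bounded/dual_continuous.
exists (`|C| + 1); first by rewrite addr_ge0.
by apply: fC; rewrite (le_lt_trans (ler_norm C))// ltrDl.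
Qed.

Lemma dual_norm_has_sup (f : dual) :
  has_sup [set `|f x| | x in [set x : V | `|x| <= 1]].
Proof.
split; first by exists `|f 0|, 0 => //=; rewrite normr0.
have [C C0 fC] := dual_bounded f.
exists C => _ [x/= x1 <-]; apply: (le_trans (fC x)).
by rewrite -[leRHS]mulr1 ler_wpM2l.
Qed.

Lemma dual_norm_ub (f : dual) x : `|f x| <= dual_norm f * `|x|.
Proof.
have [->|x0] := eqVneq x 0; first by rewrite linear0 !normr0 mulr0.
rewrite -ler_pdivrMr ?normr_gt0//.
have -> : `|f x| / `|x| = `|f (`|x|^-1 *: x)|.
  by rewrite linearZ/= normrM normrV ?unitfE ?normr_eq0// normr_id mulrC.
apply: (sup_ubound (dual_norm_has_sup f).2).
exists (`|x|^-1 *: x) => //=.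
by rewrite normrZ normrV ?unitfE ?normr_eq0// normr_id mulVf ?normr_eq0.
Qed.

Lemma dual_norm_le (f : dual) (C : R) :
  (forall x, `|x| <= 1 -> `|f x| <= C) -> dual_norm f <= C.
Proof.
move=> fC; apply: ge_sup; first exact: (dual_norm_has_sup f).1.
by move=> _ [x/= x1 <-]; exact: fC.
Qed.

Lemma dual_norm_ge0 (f : dual) : 0 <= dual_norm f.
Proof.
apply: (sup_ubound (dual_norm_has_sup f).2).
by exists 0; rewrite /= ?linear0 normr0.
Qed.

Lemma dual_normD (f g : dual) :
  dual_norm (f + g) <= dual_norm f + dual_norm g.
Proof.
apply: dual_norm_le => x x1; rewrite (le_trans (ler_normD _ _))// lerD//.
- by rewrite (le_trans (dual_norm_ub f x))// ler_piMr ?dual_norm_ge0.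
- by rewrite (le_trans (dual_norm_ub g x))// ler_piMr ?dual_norm_ge0.
Qed.

Lemma dual_normZ_le (a : R) (f : dual) :
  dual_norm (a *: f) <= `|a| * dual_norm f.
Proof.
apply: dual_norm_le => x x1.
rewrite normrM ler_wpM2l//.
by rewrite (le_trans (dual_norm_ub f x))// ler_piMr ?dual_norm_ge0.
Qed.

Lemma dual_normZ (a : R) (f : dual) : dual_norm (a *: f) = `|a| * dual_norm f.
Proof.
apply/eqP; rewrite eq_le dual_normZ_le/=.
have [->|a0] := eqVneq a 0; first by rewrite normr0 mul0r dual_norm_ge0.
rewrite -ler_pdivlMl ?normr_gt0// -{1}(scalerK a0 f).
by rewrite (le_trans (dual_normZ_le _ _))// normfV.
Qed.

Lemma dual_norm_eq0 (f : dual) : dual_norm f = 0 -> f = 0.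
Proof.
move=> f0; apply: dualP => x.
by apply/eqP; rewrite -normr_le0 (le_trans (dual_norm_ub f x))// f0 mul0r.
Qed.

HB.instance Definition _ := Lmodule_isNormed.Build R dual
  dual_normD dual_normZ dual_norm_eq0.

Let dual_mdist (f g : dual) : R := `|f - g|.

Let dual_mdist_ge0 f g : 0 <= dual_mdist f g.
Proof. exact: normr_ge0. Qed.

Let dual_mdist_positivity f g : dual_mdist f g = 0 -> f = g.
Proof. by move=> /normr0_eq0/subr0_eq. Qed.

Let dual_ballEmdist (f : dual) d : ball f d = [set g | dual_mdist f g < d].
Proof. by rewrite -ball_normE. Qed.

HB.instance Definition _ := PseudoMetric_isMetric.Build R dual
  dual_mdist_ge0 dual_mdist_positivity dual_ballEmdist.

Lemma dual_mdistE (f g : dual) : mdist f g = `|f - g|.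
Proof. by []. Qed.

End dual_lmodule.

Section bidual.
Context (R : realType) (V : normedModType R).

Lemma eval_continuous_linear (x : V) :
  (fun f : dual V => f x) \in @continuous_linear_form R (dual V).
Proof.
apply/continuous_linear_formP.
have evl : linear (fun f : dual V => f x : R^o) by [].
split=> //.
pose ev := HB.pack_for {linear dual V -> R^o} (fun f : dual V => f x : R^o)
  (GRing.isLinear.Build R (dual V) R^o *:%R _ evl).
apply: (@bounded_linear_continuous _ _ _ ev).
apply/linear_boundedP; exists `|x|; split; first exact: num_real.
move=> r xr f /=; rewrite (le_trans (dual_norm_ub f x))// mulrC.
by rewrite ler_wpM2r ?dual_norm_ge0// ltW.
Qed.

Definition canonical_embedding (x : V) : dual (dual V) :=
  Dual (eval_continuous_linear x).

End bidual.

(* The classes of the [e i] span the quotient [V / Y]. *)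
Definition finite_codimension (R : realType) (V : lmodType R) (Y : set V) :=
  exists (n : nat) (e : 'I_n -> V), forall x : V, exists a : 'I_n -> R,
    Y (x - \sum_(i < n) a i *: e i).

Definition quasi_reflexive (R : realType) (X : normedModType R) :=
  finite_codimension (range (@canonical_embedding R X)).

Section asymptotic_uniform_smoothness.
Context (R : realType) (V : normedModType R).
Implicit Types (N : V -> R) (p t : R) (Y : set V).

Definition equivalent_norm N :=
  [/\ forall x y, N (x + y) <= N x + N y,
      forall (a : R) x, N (a *: x) = `|a| * N x,
      forall x, N x = 0 -> x = 0 &
      exists c C : R, [/\ 0 < c, 0 < C &
        forall x, c * `|x| <= N x <= C * `|x|]].

Definition closed_finite_codimensional_subspace Y :=
  [/\ submod_closed (mem Y), closed Y & finite_codimension Y].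

Definition unit_sphere N : set V := [set x | N x = 1].

(* With values in [\bar R], so that the suprema and infima are unconditional.
   For [V] finite-dimensional, [Y] may be [0], whose sphere is empty; the value
   is then [-oo], and the condition below holds, as it does in the convention
   where the modulus is [0]. *)
Definition aus_modulus N t : \bar R :=
  ereal_sup [set
    ereal_inf [set
      ereal_sup [set (N (x + t *: y) - 1)%:E | y in Y `&` unit_sphere N]
    | Y in closed_finite_codimensional_subspace]
  | x in unit_sphere N].

Definition p_AUS p N :=
  exists2 c : R, 0 < c &
    forall t, 0 <= t -> (aus_modulus N t <= (c * t `^ p)%:E)%E.

Definition p_AUS_renormable p := exists2 N, equivalent_norm N & p_AUS p N.

End asymptotic_uniform_smoothness.

Section graph_distance.
Context (R : realType) (T : choiceType) (e : rel T).

Definition graph_dist (x y : T) : R :=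
  inf [set (size s)%:R | s in [set s : seq T | path e x s /\ last x s = y]].

Context (e_sym : symmetric e)
  (e_conn : forall x y, exists2 s, path e x s & last x s = y).

Lemma graph_dist_le x y s :
  path e x s -> last x s = y -> graph_dist x y <= (size s)%:R.
Proof.
move=> ps ls; apply: ge_inf; last by exists s.
by exists 0 => _ [u _ <-].
Qed.

Lemma graph_dist_attained x y :
  exists s, [/\ path e x s, last x s = y & graph_dist x y = (size s)%:R].
Proof.
pose P n := `[< exists s, [/\ path e x s, last x s = y & size s = n] >].
have exP : exists n, P n.
  by have [s ps ls] := e_conn x y; exists (size s); apply/asboolP; exists s.
case: (ex_minnP exP) => n /asboolP[s [ps ls sn]] nmin.
exists s; split=> //; apply/eqP; rewrite eq_le; apply/andP; split.
  exact: graph_dist_le ls.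
apply: lb_le_inf; first by exists (size s)%:R, s.
move=> _ [u [pu lu] <-]; rewrite ler_nat sn; apply: nmin.
by apply/asboolP; exists u.
Qed.

Lemma graph_distxx x : graph_dist x x = 0.
Proof.
have [s [ps ls ds]] := graph_dist_attained x x.
apply/eqP; rewrite eq_le {2}ds ler0n andbT.
exact: (@graph_dist_le x x [::]).
Qed.

Lemma graph_dist_positivity x y : graph_dist x y = 0 -> x = y.
Proof.
have [s [ps <- ->]] := graph_dist_attained x y.
by move=> /eqP; rewrite pnatr_eq0 => /nilP ->.
Qed.

Let graph_dist_sym_le x y : graph_dist y x <= graph_dist x y.
Proof.
have [s [ps ls ->]] := graph_dist_attained x y.
have prs : path e y (rev (belast x s)).
  by rewrite -ls rev_path; under eq_path => ? ? do rewrite e_sym.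
have lrs : last y (rev (belast x s)) = x.
  by case: {ps prs} s ls => [/= ->//|z s _]; rewrite /= rev_cons last_rcons.
by have := graph_dist_le prs lrs; rewrite size_rev size_belast.
Qed.

Lemma graph_dist_sym x y : graph_dist x y = graph_dist y x.
Proof. by apply/eqP; rewrite eq_le !graph_dist_sym_le. Qed.

Lemma graph_dist_triangle y x z :
  graph_dist x z <= graph_dist x y + graph_dist y z.
Proof.
have [s [ps ls ->]] := graph_dist_attained x y.
have [u [pu lu ->]] := graph_dist_attained y z.
by rewrite -natrD -size_cat graph_dist_le ?cat_path ?last_cat ?ls// ps.
Qed.

End graph_distance.

(* A [k]-subset of [nat] is encoded as the increasing list of its elements; [R]
   is only recorded so that the type carries a [metricType R] structure. *)
Definition interlaced_graph (_ : realType) (k : nat) :=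
  {t : k.-tuple nat | sorted ltn t}.

Section interlaced_graph.
Context (R : realType) (k : nat).

HB.instance Definition _ := Choice.on (interlaced_graph R k).

Implicit Types m n : interlaced_graph R k.

(* [n_1 <= m_1 <= n_2 <= m_2 <= ... <= n_k <= m_k] *)
Definition interlaced n m : bool :=
  [forall i, tnth (val n) i <= tnth (val m) i]%N &&
  [forall i : 'I_k, forall j : 'I_k,
    (j == i.+1 :> nat) ==> (tnth (val m) i <= tnth (val n) j)%N].

Definition interlaced_adj m n : bool :=
  (m != n) && (interlaced n m || interlaced m n).

Lemma interlaced_adj_sym : symmetric interlaced_adj.
Proof. by move=> m n; rewrite /interlaced_adj eq_sym orbC. Qed.

Let reach m n := exists2 s, path interlaced_adj m s & last m s = n.

Let reach_trans n m p : reach m n -> reach n p -> reach m p.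
Proof.
move=> [s ps ls] [u pu lu]; exists (s ++ u); first by rewrite cat_path ps ls.
by rewrite last_cat ls.
Qed.

Let reach_sym m n : reach m n -> reach n m.
Proof.
move=> [s ps ls]; exists (rev (belast m s)).
  rewrite -ls rev_path; under eq_path => ? ? do rewrite interlaced_adj_sym.
  by [].
by case: s ls {ps} => [/= ->//|z s _]; rewrite /= rev_cons last_rcons.
Qed.

Let window_subproof (f : nat -> nat) (j : nat) :
  {homo f : a b / (a < b)%N} -> sorted ltn (map_tuple f (iota_tuple k j)).
Proof. by move=> fi; exact: (@homo_sorted _ _ f ltn ltn fi (iota j k) (iota_ltn_sorted j k)). Qed.

Let window f (fi : {homo f : a b / (a < b)%N}) j : interlaced_graph R k :=
  exist _ (map_tuple f (iota_tuple k j)) (window_subproof j fi).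

Let tnth_window f (fi : {homo f : a b / (a < b)%N}) j i :
  tnth (val (window fi j)) i = f (j + i)%N.
Proof. by rewrite tnth_map (tnth_nth 0%N)/= nth_iota. Qed.

Let reach_window f (fi : {homo f : a b / (a < b)%N}) j :
  reach (window fi 0) (window fi j).
Proof.
elim: j => [|j ih]; first by exists [::].
apply: (reach_trans ih).
have [->|neq] := eqVneq (window fi j) (window fi j.+1); first by exists [::].
exists [:: window fi j.+1] => //=; rewrite andbT /interlaced_adj neq/=.
apply/orP; right; apply/andP; split.
  by apply/forallP => i; rewrite !tnth_window; apply: ltnW; apply: (fi); rewrite addSn.
apply/forallP => a; apply/forallP => b; apply/implyP => /eqP ba.
by rewrite !tnth_window ba addSnnS.
Qed.

Lemma interlaced_adj_connected m n :
  exists2 s, path interlaced_adj m s & last m s = n.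
Proof.
pose N := (\max_(i < k) maxn (tnth (val m) i) (tnth (val n) i)).+1.
have far p : (forall i, tnth (val p) i < N)%N ->
    exists f (fi : {homo f : a b / (a < b)%N}),
      window fi 0 = p /\ (forall i, f (k + i) = N + i)%N.
  move=> pN.
  pose f i := if (i < k)%N then nth 0%N (val p) i else (N + (i - k))%N.
  have fi : {homo f : a b / (a < b)%N}.
    move=> a b ab; rewrite /f; case: (ltnP a k) => ak; case: (ltnP b k) => bk.
    - have sp : sorted ltn (val p) := svalP p.
      by apply: (@sorted_ltn_nth _ ltn ltn_trans 0%N _ sp a b);
        rewrite ?inE ?size_tuple.
    - have := pN (Ordinal ak); rewrite (tnth_nth 0%N)/= => h.
      by rewrite (leq_trans h)// leq_addr.
    - by have := leq_ltn_trans ak (ltn_trans ab bk); rewrite ltnn.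
    - by rewrite ltn_add2l ltn_sub2r// (leq_ltn_trans ak).
  exists f, fi; split.
    apply: val_inj; apply: eq_from_tnth => i; rewrite tnth_window add0n /f ltn_ord.
    by rewrite -tnth_nth.
  by move=> i; rewrite /f ltnNge leq_addr/= addKn.
have [f [fi [fm fN]]] : exists f (fi : {homo f : a b / (a < b)%N}),
    window fi 0 = m /\ (forall i, f (k + i) = N + i)%N.
  apply: far => i; rewrite ltnS (bigD1 i)//=.
  by rewrite leq_max leq_maxl.
have [g [gi [gn gN]]] : exists f (fi : {homo f : a b / (a < b)%N}),
    window fi 0 = n /\ (forall i, f (k + i) = N + i)%N.
  apply: far => i; rewrite ltnS (bigD1 i)//=.
  by rewrite leq_max leq_maxr.
have fgk : window fi k = window gi k.
  by apply: val_inj; apply: eq_from_tnth => i; rewrite !tnth_window fN gN.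
apply: (@reach_trans (window fi k)); first by rewrite -fm; exact: reach_window.
by apply: reach_sym; rewrite fgk -gn; exact: reach_window.
Qed.

HB.instance Definition _ := isMetric.Build R (interlaced_graph R k)
  (graph_distxx R interlaced_adj_connected)
  (graph_dist_positivity (R := R) interlaced_adj_connected)
  (graph_dist_sym R interlaced_adj_sym interlaced_adj_connected)
  (graph_dist_triangle R interlaced_adj_connected).

Lemma interlaced_mdistE m n : mdist m n = graph_dist R interlaced_adj m n.
Proof. by []. Qed.

End interlaced_graph.

Section coarse_embedding.
Context (R : realType).

Section moduli.
Context (M N : metricType R) (f : M -> N).

Definition compression_modulus (t : R) : \bar R :=
  ereal_inf [set (mdist (f z.1) (f z.2))%:E
            | z in [set z : M * M | t <= mdist z.1 z.2]].

(* The maximum with [0] makes the supremum over the empty set equal to [0]. *)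
Definition expansion_modulus (t : R) : \bar R :=
  maxe 0%E (ereal_sup [set (mdist (f z.1) (f z.2))%:E
                    | z in [set z : M * M | mdist z.1 z.2 <= t]]).

End moduli.

Definition equi_coarsely_embeds (I : Type) (M : I -> metricType R)
    (N : metricType R) :=
  exists (rho omega : R -> R) (f : forall i, M i -> N),
    [/\ forall t : R, 0 <= t -> 0 <= rho t /\ 0 <= omega t,
        rho t @[t --> +oo] --> +oo &
        forall i (t : R), 0 <= t ->
          ((rho t)%:E <= compression_modulus (f i) t)%E /\
          (expansion_modulus (f i) t <= (omega t)%:E)%E].

End coarse_embedding.

(* Main.v *)
Require Import Defs.
From HB Require Import structures.
From mathcomp Require Import all_boot all_order all_algebra.
From mathcomp Require Import all_classical all_reals all_analysis.
From mathcomp Require Import ring lra.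

(** The family of Kalton graphs is excluded by a concentration argument on
    weak* null trees in the bidual, in which a lower and an upper p-estimate
    are played against each other.

    Fix a nonprincipal ultrafilter U on the natural numbers. A bounded map F
    from the k-subsets of nat to X** extends to all lists of length at most k
    by iterated weak* limits along U ([weak_star_tree]); then F is the sum,
    along a branch of the tree of lists, of increments that are weak* null
    along U.

    Lower estimate ([weak_star_lower_estimate]). If the norm of V is p-AUS, its
    dual norm on V* satisfies, for weak* null (g_n) and the conjugate q,
      lim |f + g_n|^q >= |f|^q + k lim |g_n|^q.
    Testing g_n on vectors of a finite-codimensional subspace Y on which the
    p-AUS inequality holds gives this. Vectors of Y are produced as
    u_n - u_m, where u_n almost norms g_n: finitely many functionals whose
    common kernel lies in Y converge along (u_n), hence almost vanish on the
    difference. The price is a constant (the norm of u_n - u_m may be 2), and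
    the gain is that no extension or separation theorem is called for. Applied
    to V = X*, it yields a lower p-estimate in X**. If F moves interlaced
    k-subsets by at most om, applying it along two interlaced branches bounds
    the sum of the p-th powers of the norms of the increments by a constant
    that depends on om but not on k ([interleaved_branch]).

    Upper estimate ([weak_star_upper_near]). Applied to V = X, the lower
    estimate in X* dualizes, by Hoelder's inequality, to
      lim |S + z_n|^p <= |S|^p + C lim |z_n|^p
    for weak* null (z_n) in X**, but only when S is near the image of X,
    because S has to be almost weak* continuous. Here quasi-reflexivity comes
    in: nearness to X is decided by finitely many functionals on X**
    ([quasi_reflexive_near]), whose values on the nodes of the tree can be made
    to depend on the length of the node only. So the difference of two nodes of
    the same length is near X.

    Conclusion ([nonconcentration]). For k much larger than r, some block of r
    consecutive levels carries increments of norm at most 1/r. Two branches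
    agree up to this block, then use disjoint integers in the block, one set
    after the other, and again the same integers afterwards. The images of
    their ends are at bounded distance: at most 2 after the block by the
    triangle inequality, and the rest by the upper estimate, since the common
    part moves them by differences of increments whose p-th powers have a
    bounded sum. But the ends are at distance at least r in the graph: counting
    the elements below a given integer is a 1-Lipschitz function
    ([count_mdist]). As r is arbitrary, the compression moduli stay bounded. *)

Set Implicit Arguments.
Unset Strict Implicit.
Unset Printing Implicit Defensive.

Import Order.TTheory GRing.Theory Num.Theory.
Import numFieldNormedType.Exports.

Local Open Scope classical_set_scope.
Local Open Scope ring_scope.

(** * Real powers and ultralimits of reals *)

Section powers.
Context (R : realType).
Implicit Types p q x y B : R.

Lemma conj_exponent p q : 1 < p -> p^-1 + q^-1 = 1 -> 1 < q /\ p * (q - 1) = q.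
Proof.
move=> p1 pq.
have p0 : 0 < p by lra.
have qV : q^-1 = 1 - p^-1 by lra.
have pV1 : p^-1 < 1 by rewrite invf_lt1.
have pV0 : 0 < p^-1 by rewrite invr_gt0.
have q0 : 0 < q by rewrite -invr_gt0 qV subr_gt0.
split.
  by rewrite -[q]invrK invf_gt1 ?invr_gt0// qV; lra.
have : p * q * (p^-1 + q^-1) = p * q by rewrite pq mulr1.
have -> : p * q * (p^-1 + q^-1) = q + p by field; lra.
by lra.
Qed.

(** This is the mean value inequality for the convex function x^p; it follows
    from Young's inequality applied to x^(p-1) and y. *)
Lemma powR_sub_le p x y B : 1 < p -> 0 <= y -> y <= x -> x <= B ->
  x `^ p - y `^ p <= p * B `^ (p - 1) * (x - y).
Proof.
move=> p1 y0 yx xB.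
have p0 : 0 < p by lra.
have x0 : 0 <= x by lra.
set q := p / (p - 1).
have q0 : 0 < q by rewrite divr_gt0//; lra.
have pq : p^-1 + q^-1 = 1 by rewrite /q; field; lra.
have qpp : (x `^ (p - 1)) `^ q = x `^ p.
  by rewrite -powRrM; congr (_ `^ _); rewrite /q; field; lra.
have pqq : q^-1 + p^-1 = 1 by lra.
have /= := @conjugate_powR R _ _ q p (powR_ge0 x (p - 1)) y0 q0 p0 pqq.
rewrite qpp => young.
have xE : x * x `^ (p - 1) = x `^ p by rewrite mulr_powRB1.
apply: (@le_trans _ _ (p * x `^ (p - 1) * (x - y))).
  have : p * (x `^ (p - 1) * y) <= p * (x `^ p / q + y `^ p / p).
    by rewrite ler_wpM2l// ltW.
  have -> : p * (x `^ p / q + y `^ p / p) = (p - 1) * x `^ p + y `^ p.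
    by rewrite /q; field; lra.
  by rewrite mulrBr -!mulrA (mulrC _ x) xE; lra.
apply: ler_wpM2r; first lra.
apply: ler_wpM2l; first lra.
by apply: ge0_ler_powR; rewrite ?nnegrE//; lra.
Qed.

Lemma powR_le_inv p x y : 0 < p -> 0 <= x -> 0 <= y -> x `^ p <= y `^ p -> x <= y.
Proof.
move=> p0 x0 y0; apply: contraTT; rewrite -!ltNge => yx.
by apply: gt0_ltr_powR; rewrite ?nnegrE.
Qed.

Lemma powR_add_le p x y (b : R) : 0 < p -> 0 <= x -> 0 <= y ->
  x `^ p <= b -> y `^ p <= b -> (x + y) `^ p <= 2 `^ p * b.
Proof.
move=> p0.
have aux (a c : R) : 0 <= a -> a <= c -> c `^ p <= b ->
    (a + c) `^ p <= 2 `^ p * b.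
  move=> a0 ac cb; apply: (@le_trans _ _ ((2 * c) `^ p)).
    by apply: ge0_ler_powR; rewrite ?nnegrE//; lra.
  rewrite powRM//; last by lra.
  by apply: ler_wpM2l => //; exact: powR_ge0.
move=> x0 y0 xb yb; have [xy|/ltW yx] := leP x y; first exact: aux.
by rewrite addrC; exact: aux.
Qed.

Lemma cvg_powR (U : set_system nat) (UF : Filter U) p (u : nat -> R) (l : R) :
  1 < p -> (forall n, 0 <= u n) -> 0 <= l -> u n @[n --> U] --> l ->
  u n `^ p @[n --> U] --> l `^ p.
Proof.
move=> p1 u0 l0 ul.
set B := l + 1; set C := p * B `^ (p - 1).
have C0 : 0 <= C by rewrite mulr_ge0 ?powR_ge0//; lra.
apply/cvgrPdist_le => e e0.
have d0 : 0 < Num.min 1 (e / (C + 1)).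
  by rewrite lt_min ltr01 divr_gt0//; lra.
move/cvgrPdist_le : ul => /(_ _ d0); apply: filterS => n.
rewrite le_min => /andP[h1 h2].
have he : C * `|l - u n| <= e.
  have : `|l - u n| * (C + 1) <= e by rewrite -ler_pdivlMr//; lra.
  by have := normr_ge0 (l - u n); nra.
have uB : u n <= B by rewrite /B; move: h1; rewrite ler_norml; lra.
have [lu|ul] := leP l (u n).
  rewrite distrC ger0_norm; last first.
    by rewrite subr_ge0 ge0_ler_powR ?nnegrE//; lra.
  apply: le_trans he; apply: le_trans (powR_sub_le p1 l0 lu uB) _.
  by rewrite distrC ger0_norm//; lra.
rewrite ger0_norm; last by rewrite subr_ge0 ge0_ler_powR ?nnegrE//; lra.
apply: le_trans he; apply: le_trans (powR_sub_le p1 (u0 n) (ltW ul) (_ : l <= B)) _.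
  by rewrite /B; lra.
by rewrite ger0_norm//; lra.
Qed.

(** Hoelder's inequality in dimension 2, where the weight k is split between
    the two factors: a lower q-estimate in a dual becomes an upper p-estimate
    with the constant k^(-p/q). *)
Lemma dual_pair_powR p q k a t A T : 1 < p -> p^-1 + q^-1 = 1 -> 0 < k ->
  0 <= a -> 0 <= t -> 0 <= A -> 0 <= T -> a `^ q + k * t `^ q <= 1 ->
  (a * A + t * T) `^ p <= A `^ p + k `^ (- (p / q)) * T `^ p.
Proof.
move=> p1 pq k0 a0 t0 A0 T0 akt.
have [q1 _] := conj_exponent p1 pq.
have q0 : 0 < q by lra.
have p0 : 0 < p by lra.
set c := k `^ q^-1.
have c0 : 0 < c by rewrite powR_gt0.
have ckq : c `^ q = k by rewrite -powRrM mulVf ?powRr1 ?gt_eqF// ltW.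
have qp : q^-1 + p^-1 = 1 by lra.
have cT : 0 <= c^-1 * T by rewrite mulr_ge0// invr_ge0 ltW.
have ct : 0 <= c * t by rewrite mulr_ge0// ltW.
have cp : (c^-1) `^ p = k `^ (- (p / q)).
  rewrite powRN -powR_inv1 ?ltW// -powRrM mulN1r powRN -powRrM.
  by rewrite (mulrC p).
have := @hoelder2 R a (c * t) A (c^-1 * T) q p a0 ct A0 cT q0 p0 qp.
have -> : c * t * (c^-1 * T) = t * T by field; rewrite gt_eqF.
rewrite (powRM _ (ltW c0) t0) ckq powRM ?invr_ge0 ?(ltW c0)// cp.
set E := (A `^ p + _) => h.
have E0 : 0 <= E by rewrite addr_ge0 ?mulr_ge0 ?powR_ge0.
have h1 : (a `^ q + k * t `^ q) `^ q^-1 <= 1.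
  have -> : 1 = 1 `^ q^-1 :> R by rewrite powR1.
  apply: ge0_ler_powR; rewrite ?nnegrE ?invr_ge0//; first lra.
  by rewrite addr_ge0 ?mulr_ge0 ?powR_ge0// ltW.
have h2 : a * A + t * T <= E `^ p^-1.
  by apply: le_trans h _; rewrite ler_piMl ?powR_ge0.
have -> : E = (E `^ p^-1) `^ p by rewrite -powRrM mulVf ?powRr1 ?gt_eqF.
apply: ge0_ler_powR; rewrite ?nnegrE ?powR_ge0//; first exact: ltW.
by rewrite addr_ge0 ?mulr_ge0.
Qed.

End powers.

Section ultralimits.
Context (R : realType) (U : set_system nat) (UU : UltraFilter U).

Lemma ultra_cvg (u : nat -> R) (B : R) : (forall n, `|u n| <= B) ->
  exists2 l : R, `|l| <= B & u n @[n --> U] --> l.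
Proof.
move=> uB.
have [|l []] := @segment_compact R (- B) B (u @ U) (fmap_proper_filter _ _).
  by apply: (@filterE _ U) => n; rewrite /= in_itv/= -ler_norml.
rewrite /= in_itv/= -ler_norml => lB cl.
exists l => // A Al.
have [//|UnA] := in_ultra_setVsetC (u @^-1` A) UU.
by have [x [nAx Ax]] := cl (~` A) A UnA Al; case: (nAx Ax).
Qed.

End ultralimits.

(** * Dual norms and weak* limits *)

Section equivalent_norms.
Context (R : realType) (V : normedModType R) (N : V -> R).
Hypothesis hN : equivalent_norm N.

Lemma enormD x y : N (x + y) <= N x + N y. Proof. by have [] := hN. Qed.

Lemma enormZ (a : R) x : N (a *: x) = `|a| * N x. Proof. by have [] := hN. Qed.

Lemma enorm0 : N 0 = 0.
Proof. by rewrite -(scale0r 0) enormZ normr0 mul0r. Qed.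

Lemma enormN x : N (- x) = N x.
Proof. by rewrite -scaleN1r enormZ normrN1 mul1r. Qed.

Lemma enormB x y : N (x - y) <= N x + N y.
Proof. by rewrite (le_trans (enormD _ _))// enormN. Qed.

Lemma enorm_ge0 x : 0 <= N x.
Proof. by have := enormB x x; rewrite subrr enorm0; lra. Qed.

Lemma enorm_sum n (v : 'I_n -> V) : N (\sum_(i < n) v i) <= \sum_(i < n) N (v i).
Proof.
elim: n v => [|n ih] v; first by rewrite !big_ord0 enorm0.
by rewrite !big_ord_recr/= (le_trans (enormD _ _))// lerD.
Qed.

(** The dual norm of N: the gauge of the polar of its unit ball. *)
Definition polar (f : dual V) : R :=
  sup [set `|f x| | x in [set x : V | N x <= 1]].

Lemma polar_has_sup (f : dual V) :
  has_sup [set `|f x| | x in [set x : V | N x <= 1]].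
Proof.
split; first by exists `|f 0|, 0 => //=; rewrite enorm0.
have [C C0 fC] := dual_bounded f.
have [_ _ _ [c [C' [c0 C'0 cN]]]] := hN.
exists (C / c) => _ [x/= x1 <-]; apply: (le_trans (fC x)).
apply: ler_wpM2l => //; rewrite -[leRHS]mul1r ler_pdivlMr// mulrC.
by apply: le_trans x1; have /andP[] := cN x.
Qed.

Lemma polar_ub (f : dual V) x : `|f x| <= polar f * N x.
Proof.
have [x0|x0] := eqVneq (N x) 0.
  have [_ _ /(_ _ x0) -> _] := hN.
  by rewrite linear0 enorm0 mulr0 normr0.
have Nx0 : 0 < N x by rewrite lt_neqAle eq_sym x0 enorm_ge0.
rewrite -ler_pdivrMr//.
have -> : `|f x| / N x = `|f ((N x)^-1 *: x)|.
  by rewrite linearZ/= normrM gtr0_norm ?invr_gt0// mulrC.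
apply: (sup_ubound (polar_has_sup f).2); exists ((N x)^-1 *: x) => //=.
by rewrite enormZ gtr0_norm ?invr_gt0// mulVf.
Qed.

Lemma polar_le (f : dual V) (C : R) :
  (forall x, N x <= 1 -> `|f x| <= C) -> polar f <= C.
Proof.
move=> fC; apply: ge_sup; first exact: (polar_has_sup f).1.
by move=> _ [x/= x1 <-]; exact: fC.
Qed.

Lemma polar_approx (f : dual V) (e : R) : 0 < e ->
  exists2 x, N x <= 1 & polar f - e < f x.
Proof.
move=> e0.
have [_ [x/= x1 <-] fx] := sup_adherent e0 (polar_has_sup f).
have [f0|f0] := leP 0 (f x).
  by exists x => //; rewrite -[ltRHS]ger0_norm.
exists (- x); first by rewrite enormN.
by rewrite linearN/= -[ltRHS]ltr0_norm.
Qed.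

Lemma polar_equivalent_norm : equivalent_norm polar.
Proof.
have [_ _ Neq0 [c [C [c0 C0 cN]]]] := hN.
have p0 f : 0 <= polar f.
  apply: (sup_ubound (polar_has_sup f).2).
  by exists 0; rewrite /= ?linear0 ?enorm0 ?normr0.
have Zle a f : polar (a *: f) <= `|a| * polar f.
  apply: polar_le => x x1; rewrite normrM ler_wpM2l//.
  by rewrite (le_trans (polar_ub f x))// ler_piMr.
split.
- move=> f g; apply: polar_le => x x1; rewrite (le_trans (ler_normD _ _))// lerD//.
  + by rewrite (le_trans (polar_ub f x))// ler_piMr.
  + by rewrite (le_trans (polar_ub g x))// ler_piMr.
- move=> a f; apply/eqP; rewrite eq_le Zle/=.
  have [->|a0] := eqVneq a 0; first by rewrite normr0 mul0r.
  rewrite -ler_pdivlMl ?normr_gt0// -{1}(scalerK a0 f).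
  by rewrite (le_trans (Zle _ _))// normfV.
- move=> f f0; apply: dualP => x.
  by apply/eqP; rewrite -normr_le0 (le_trans (polar_ub f x))// f0 mul0r.
- exists C^-1, c^-1; rewrite !invr_gt0; split => // f; apply/andP; split.
    rewrite mulrC ler_pdivrMr//; apply: dual_norm_le => x x1.
    apply: (le_trans (polar_ub f x)); apply: ler_wpM2l => //.
    have /andP[_ h] := cN x; apply: le_trans h _.
    by rewrite ler_piMr// ltW.
  apply: polar_le => x x1; apply: (le_trans (dual_norm_ub f x)).
  rewrite mulrC; apply: ler_wpM2r; first exact: dual_norm_ge0.
  rewrite -[leRHS]mul1r ler_pdivlMr// mulrC; apply: le_trans x1.
  by have /andP[] := cN x.
Qed.

(** Along an ultrafilter the pointwise limits exist, and they form a bounded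
    functional: this is the sequential form of the Banach-Alaoglu theorem that
    suffices for countable trees. *)
Lemma weak_star_limit (U : set_system nat) (UU : UltraFilter U)
    (f : nat -> dual V) (B : R) : (forall n, polar (f n) <= B) ->
  exists2 g : dual V, polar g <= B & forall x, f n x @[n --> U] --> (g x : R).
Proof.
move=> fB.
have B0 : 0 <= B.
  apply: le_trans (fB 0%N); apply: (sup_ubound (polar_has_sup _).2).
  by exists 0; rewrite /= ?linear0 ?enorm0 ?normr0.
have fxB x n : `|f n x| <= B * N x.
  by apply: (le_trans (polar_ub _ _)); rewrite ler_wpM2r ?enorm_ge0.
have [g0 g0P] : exists g : V -> R, forall x, `|g x| <= B * N x /\
    f n x @[n --> U] --> (g x : R).
  have [x|g0 g0P] := @boolp.choice V R (fun x (y : R) => `|y| <= B * N x /\ f n x @[n --> U] --> y).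
    by have [l lB fl] := ultra_cvg UU (fxB x); exists l.
  by exists g0.
have g0l : linear (g0 : V -> R^o).
  move=> a x y; apply: (@cvg_unique _ (@Rhausdorff R) (f n (a *: x + y) @[n --> U])).
  - exact: (g0P _).2.
  - rewrite (_ : (fun n => f n (a *: x + y)) = (fun n => a * f n x + f n y :> R)); last first.
      by apply/funext => n; rewrite linearP.
    apply: cvgD; last exact: (g0P y).2.
    by apply: cvgMr; exact: (g0P x).2.
have [_ _ _ [c [C [c0 C0 cN]]]] := hN.
pose gl := HB.pack_for {linear V -> R^o} (g0 : V -> R^o)
  (GRing.isLinear.Build R V R^o *:%R _ g0l).
have g0c : continuous (g0 : V -> R^o).
  apply: (@bounded_linear_continuous _ _ _ gl).
  apply/linear_boundedP; exists (B * C); split; first exact: num_real.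
  move=> r rBC x /=; apply: (le_trans (g0P x).1).
  apply: (@le_trans _ _ (B * C * `|x|)); last by rewrite ler_wpM2r// ltW.
  by rewrite -mulrA ler_wpM2l//; have /andP[] := cN x.
have g0in : (g0 : V -> R^o) \in @continuous_linear_form R V.
  by apply/continuous_linear_formP; split.
exists (Dual g0in); last by move=> x; exact: (g0P x).2.
apply: polar_le => x x1; apply: (le_trans (g0P x).1).
by rewrite ler_piMr.
Qed.

End equivalent_norms.

(** * Closed subspaces of finite codimension *)

Lemma nonprincipal_ultrafilter : exists2 U : set_system nat, UltraFilter U &
  forall m, \forall n \near U, (m < n)%N.
Proof.
have [U [UU oU]] := ultraFilterLemma eventually_filter.
by exists U => // m; apply: oU; exists m.+1.
Qed.

Section finite_codimension.
Context (R : realType) (V : normedModType R).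
Implicit Types Y : set V.

Lemma submod_set_intro Y : Y 0 ->
  (forall (a : R) u v, Y u -> Y v -> Y (a *: u + v)) -> submod_closed (mem Y).
Proof. by move=> Y0 Yl; split=> [|a u v]; rewrite !inE//; exact: Yl. Qed.

Lemma submod_set0 Y : submod_closed (mem Y) -> Y 0.
Proof. by case=> + _; rewrite inE. Qed.

Lemma submod_setP Y : submod_closed (mem Y) ->
  forall (a : R) u v, Y u -> Y v -> Y (a *: u + v).
Proof. by case=> _ h a u v Yu Yv; have := h a u v; rewrite !inE; apply. Qed.

Lemma submod_setZ Y : submod_closed (mem Y) ->
  forall (a : R) u, Y u -> Y (a *: u).
Proof.
move=> hY a u Yu; rewrite -[_ *: _]addr0; apply: submod_setP => //.
exact: submod_set0.
Qed.

Lemma submod_setB Y : submod_closed (mem Y) ->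
  forall u v, Y u -> Y v -> Y (u - v).
Proof. by move=> hY u v Yu Yv; rewrite addrC -scaleN1r; exact: submod_setP. Qed.

Lemma closed_approx Y v : closed Y ->
  (forall e : R, 0 < e -> exists2 y, Y y & `|v - y| < e) -> Y v.
Proof.
move=> cY h; apply: cY => B /nbhs_ballP[e /= e0 eB].
have [y Yy vy] := h e e0; exists y; split=> //; apply: eB.
by rewrite -ball_normE.
Qed.

Lemma closed_separated Y e : closed Y -> ~ Y e ->
  exists2 d : R, 0 < d & forall y, Y y -> d <= `|e - y|.
Proof.
move=> cY Ye; apply: contrapT => h; apply: Ye; apply: closed_approx => // d d0.
apply: contrapT => h'; apply: h; exists d => // y Yy.
by rewrite leNgt; apply/negP => ey; apply: h'; exists y.
Qed.

(** By homogeneity, as e - v/a lies in Y. This is what makes the coordinate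
    along e continuous on Y + R e. *)
Lemma line_coordinate_bounded Y e (d : R) : submod_closed (mem Y) ->
  (forall y, Y y -> d <= `|e - y|) ->
  forall (a : R) v, Y (v - a *: e) -> `|a| * d <= `|v|.
Proof.
move=> hY de a v Yv.
have [->|a0] := eqVneq a 0; first by rewrite normr0 mul0r.
have := de (e - a^-1 *: v); rewrite subKr normrZ normfV.
have -> : e - a^-1 *: v = - a^-1 *: (v - a *: e).
  by rewrite scalerBr scalerA mulNr mulVf// scaleN1r scaleNr opprK addrC.
move=> /(_ (submod_setZ hY _ Yv)).
by rewrite ler_pdivlMl ?normr_gt0.
Qed.

(** The coordinates along e of an approximating sequence are bounded, so they
    have an ultralimit, which is the coordinate of the limit. *)
Lemma closed_add_line Y e (d : R) : submod_closed (mem Y) -> closed Y -> 0 < d ->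
  (forall y, Y y -> d <= `|e - y|) ->
  closed [set v | exists a : R, Y (v - a *: e)].
Proof.
move=> hY cY d0 de v clv.
have near n : exists wa : V * R, Y (wa.1 - wa.2 *: e) /\ `|v - wa.1| < n.+1%:R^-1.
  have /clv[w [/= [a Yw] vw]] : nbhs v (ball v (n.+1%:R^-1 : R)).
    by apply: nbhsx_ballx; rewrite invr_gt0 ltr0n.
  by exists (w, a); split=> //; move: vw; rewrite -ball_normE.
have [wa waP] := choice near.
have [U UU Uoo] := nonprincipal_ultrafilter.
have aB n : `|(wa n).2| <= (`|v| + 1) / d.
  rewrite ler_pdivlMr//; have [Yw vw] := waP n.
  apply: (le_trans (line_coordinate_bounded hY de Yw)).
  rewrite -[(wa n).1](subrK v) addrC (le_trans (ler_normD _ _))// lerD2l distrC.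
  by rewrite (le_trans (ltW vw))// invf_le1 ?ltr0n// ler1n.
have [a _ ua] := ultra_cvg UU aB.
exists a; apply: closed_approx => // eps eps0.
pose eta := eps / 2 / (`|e| + 1).
have e1 : 0 < `|e| + 1 by rewrite ltr_wpDl.
have eta0 : 0 < eta by rewrite !divr_gt0.
have [m _ mP] := near_infty_natSinv_lt (PosNum (divr_gt0 eps0 (ltr0n _ 2))).
move/cvgrPdist_lt : ua => /(_ eta eta0) ua.
have [n [mn na]] : exists n, (m < n)%N /\ `|a - (wa n).2| < eta.
  apply: (@filter_ex _ U); apply: filterS2 (Uoo m) ua => n; by split.
have [Yw vw] := waP n.
exists ((wa n).1 - (wa n).2 *: e) => //.
have -> : v - a *: e - ((wa n).1 - (wa n).2 *: e)
    = (v - (wa n).1) - (a - (wa n).2) *: e.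
  rewrite scalerBl !opprB -!addrA; congr (_ + _).
  by rewrite [LHS]addrC -addrA [RHS]addrCA.
rewrite (le_lt_trans (ler_normB _ _))// normrZ.
have h1 : `|v - (wa n).1| < eps / 2.
  by apply: (lt_trans vw); exact: (mP n (ltnW mn)).
have h2 : `|a - (wa n).2| * `|e| <= eps / 2.
  have : `|a - (wa n).2| * (`|e| + 1) <= eps / 2.
    by rewrite -ler_pdivlMr// ltW.
  by have := normr_ge0 (a - (wa n).2); lra.
by lra.
Qed.

(** Y is the range of a bounded projection of finite corank. The coordinate
    functionals are built one vector at a time, from the distance of this
    vector to a closed subspace, and not by the Hahn-Banach theorem: each is
    the composition of the previous projection with a coordinate along a
    line. *)
Lemma finite_codim_projection Y : closed_finite_codimensional_subspace Y ->
  exists (n : nat) (e : 'I_n -> V) (th : 'I_n -> dual V),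
    forall v, Y (v - \sum_(i < n) th i v *: e i).
Proof.
move=> [hY cY [n [e ecod]]]; exists n, e.
elim: n Y hY cY e ecod => [|n ih] Y hY cY e ecod.
  by exists (fun=> 0) => v; rewrite big_ord0; have [a] := ecod v; rewrite big_ord0.
pose e' i := e (widen_ord (leqnSn n) i); pose f := e ord_max.
(* a vector that already lies in Y receives the zero functional *)
have [Yf|Yf] := pselect (Y f).
  have [v|th thP] := ih Y hY cY e'.
    have [a] := ecod v; rewrite big_ord_recr/= opprD addrA => Yv.
    exists (fun i => a (widen_ord (leqnSn n) i)).
    by have := submod_setP hY (a ord_max) Yf Yv; rewrite [X in Y X]addrC subrK.
  exists (fun i => if unlift ord_max i is Some j then th j else 0) => v.
  rewrite big_ord_recr/= unlift_none scale0r addr0.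
  have := thP v; congr (Y (_ - _)); apply: eq_bigr => i _; rewrite /e'.
  have -> : widen_ord (leqnSn n) i = lift ord_max i.
    by apply: val_inj; rewrite /= /bump leqNgt ltn_ord.
  by rewrite liftK.
have [d d0 de] := closed_separated cY Yf.
pose Y' := [set v | exists a : R, Y (v - a *: f)].
have hY' : submod_closed (mem Y').
  split; first by rewrite inE; exists 0; rewrite scale0r subr0; exact: submod_set0.
  move=> b u v; rewrite !inE => -[a Yu] [c Yv]; exists (b * a + c).
  have -> : b *: u + v - (b * a + c) *: f = b *: (u - a *: f) + (v - c *: f).
    by rewrite scalerDl scalerBr scalerA opprD !addrA; congr (_ - _); rewrite addrAC.
  exact: submod_setP.
have cY' : closed Y' by exact: closed_add_line de.
have [v|th thP] := ih Y' hY' cY' e'.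
  have [a] := ecod v; rewrite big_ord_recr/= opprD addrA => Yv.
  by exists (fun i => a (widen_ord (leqnSn n) i)), (a ord_max).
pose P v : V := v - \sum_(i < n) th i v *: e' i.
have Plin : linear P.
  move=> a u v; rewrite /P scalerBr.
  have -> : \sum_(i < n) th i (a *: u + v) *: e' i =
      a *: (\sum_(i < n) th i u *: e' i) + \sum_(i < n) th i v *: e' i.
    rewrite scaler_sumr -big_split/=; apply: eq_bigr => i _.
    by rewrite linearP scalerDl scalerA.
  by rewrite opprD !addrA; congr (_ - _); rewrite addrAC.
have Pb v : `|P v| <= (1 + \sum_(i < n) dual_norm (th i) * `|e' i|) * `|v|.
  rewrite mulrDl mul1r (le_trans (ler_normB _ _))// lerD2l.
  rewrite mulr_suml (le_trans (ler_norm_sum _ _ _))// ler_sum// => i _.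
  by rewrite normrZ -mulrAC ler_wpM2r// dual_norm_ub.
have [a aP] := choice thP.
have auniq v b c : Y (v - b *: f) -> Y (v - c *: f) -> b = c.
  move=> Yb Yc; apply/eqP; rewrite -subr_eq0 -normr_le0.
  have : `|b - c| * d <= `|0 : V|.
    apply: (line_coordinate_bounded hY de).
    have -> : 0 - (b - c) *: f = (v - b *: f) - (v - c *: f).
      by rewrite sub0r opprB [RHS]addrC addrA subrK scalerBl opprB.
    exact: submod_setB.
  by rewrite normr0 pmulr_lle0.
have alin : linear (a : V -> R^o).
  move=> b u v; rewrite -[RHS]/(b * a u + a v); apply: auniq (aP _) _.
  have -> : b *: u + v - \sum_(i < n) th i (b *: u + v) *: e' i = b *: P u + P v.
    exact: Plin.
  rewrite scalerDl.
  have -> (x y : V) (s t : R) : b *: x + y - ((b * s) *: f + t *: f)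
      = b *: (x - s *: f) + (y - t *: f).
    by rewrite scalerBr scalerA opprD !addrA; congr (_ - _); rewrite addrAC.
  by apply: submod_setP; [|exact: aP|exact: aP].
pose C := (1 + \sum_(i < n) dual_norm (th i) * `|e' i|) / d.
have ab v : `|a v| <= C * `|v|.
  rewrite /C mulrAC ler_pdivlMr//; apply: le_trans (Pb v).
  exact: line_coordinate_bounded hY de _ _ (aP v).
pose al := HB.pack_for {linear V -> R^o} (a : V -> R^o)
  (GRing.isLinear.Build R V R^o *:%R _ alin).
have acont : continuous (a : V -> R^o).
  apply: (@bounded_linear_continuous _ _ _ al).
  apply/linear_boundedP; exists C; split; first exact: num_real.
  by move=> r rC x /=; apply: (le_trans (ab x)); rewrite ler_wpM2r// ltW.
have ain : (a : V -> R^o) \in @continuous_linear_form R V.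
  by apply/continuous_linear_formP; split.
exists (fun i => if unlift ord_max i is Some j then th j else Dual ain) => v.
rewrite big_ord_recr/= unlift_none/= opprD addrA.
have := aP v; congr (Y (_ - _ - _)); apply: eq_bigr => i _; rewrite /e'.
have -> : widen_ord (leqnSn n) i = lift ord_max i.
  by apply: val_inj; rewrite /= /bump leqNgt ltn_ord.
by rewrite liftK.
Qed.

End finite_codimension.

(** * The lower estimate in the dual of an asymptotically smooth space *)

Section real_limits.
Context (R : realType) (F : set_system nat) {FF : ProperFilter F}.

Lemma cvg_sumr n (u : 'I_n -> nat -> R) (l : 'I_n -> R) :
  (forall i, u i k @[k --> F] --> l i) ->
  \sum_(i < n) u i k @[k --> F] --> \sum_(i < n) l i.
Proof.
move=> ul; apply: cvg_big => [|i _]; last exact: ul.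
exact: add_continuous.
Qed.

Lemma cvg_near_lt (u : nat -> R) (l m : R) : u k @[k --> F] --> l -> l < m ->
  \forall k \near F, u k < m.
Proof.
move=> /cvgrPdist_lt/(_ (m - l)); rewrite subr_gt0 => /[apply]; apply: filterS => k.
by rewrite distrC ltr_norml; lra.
Qed.

Lemma ler_cvg (u v : nat -> R) (l m : R) : u k @[k --> F] --> l ->
  v k @[k --> F] --> m -> (\forall k \near F, u k <= v k) -> l <= m.
Proof. exact: ler_cvg_to. Qed.

End real_limits.

Section lower_estimate.
Context (R : realType) (V : normedModType R) (N : V -> R) (p q : R).
Hypotheses (hN : equivalent_norm N) (p1 : 1 < p) (pq : p^-1 + q^-1 = 1).
Context (U : set_system nat) (UU : UltraFilter U).

Local Notation Nd := (polar N).

(** The inequality on the unit sphere of Y extends to its unit ball by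
    convexity, since s y is a convex combination of two opposite points of the
    sphere of radius s. *)
Lemma p_AUS_ball (c : R) :
  (forall t, 0 <= t -> (aus_modulus N t <= (c * t `^ p)%:E)%E) ->
  forall x (s eta : R), N x = 1 -> 0 <= s -> 0 < eta -> 0 <= c ->
  exists2 Y, closed_finite_codimensional_subspace Y &
    forall y, Y y -> N y <= 1 -> N (x + s *: y) <= 1 + c * s `^ p + eta.
Proof.
move=> haus x s eta x1 s0 eta0 c0.
have : (ereal_inf [set
      ereal_sup [set (N (x + s *: y) - 1)%:E | y in Y `&` unit_sphere N]
    | Y in @closed_finite_codimensional_subspace R V] < (c * s `^ p + eta)%:E)%E.
  apply: (@le_lt_trans _ _ (c * s `^ p)%:E); last by rewrite lte_fin ltrDl.
  apply: le_trans (haus s s0); apply: ereal_sup_ubound.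
  by exists x.
move=> /ereal_inf_lt[_ [Y hY <-] supY]; exists Y => // y Yy y1.
have sphere z : Y z -> N z = 1 -> N (x + s *: z) <= 1 + c * s `^ p + eta.
  move=> Yz z1.
  have : ((N (x + s *: z) - 1)%:E <= (c * s `^ p + eta)%:E)%E.
    by apply: le_trans (ltW supY); apply: ereal_sup_ubound; exists z.
  by rewrite lee_fin; lra.
have [Y_lin _ _] := hY.
have e0 : 0 <= c * s `^ p + eta by rewrite addr_ge0 ?mulr_ge0 ?powR_ge0// ltW.
have [y0|y0] := eqVneq (N y) 0.
  have [_ _ /(_ _ y0) -> _] := hN.
  by rewrite scaler0 addr0 x1 -addrA lerDl.
have Ny0 : 0 < N y by rewrite lt_neqAle eq_sym y0 enorm_ge0.
set l := N y in y1 y0 Ny0 *.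
pose z := l^-1 *: y.
have Nz : N z = 1 by rewrite (enormZ hN) gtr0_norm ?invr_gt0// mulVf.
have Yz : Y z by exact: submod_setZ.
have yz : y = l *: z by rewrite /z scalerA divff// scale1r.
have Yz' : Y (- z) by rewrite -scaleN1r; exact: submod_setZ.
clearbody z.
have -> : x + s *: y =
    ((1 + l) / 2) *: (x + s *: z) + ((1 - l) / 2) *: (x + s *: - z).
  rewrite !scalerDr addrACA -(scalerDl x) yz.
  have -> : (1 + l) / 2 + (1 - l) / 2 = 1 by field.
  rewrite scale1r; congr (_ + _).
  rewrite !scalerN !scalerA -scaleNr -(scalerDl z).
  by congr (_ *: _); field.
apply: le_trans (enormD hN _ _) _.
rewrite !(enormZ hN) !ger0_norm; try lra.
have h1 := sphere z Yz Nz.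
have h2 := sphere (- z) Yz' (etrans (enormN hN z) Nz).
set M := 1 + _ + _ in h1 h2 *.
have -> : M = (1 + l) / 2 * M + (1 - l) / 2 * M by field.
by rewrite lerD// ler_wpM2l//; lra.
Qed.

Lemma polar_unit_approx (f : dual V) (e : R) : 0 < e ->
  (exists x, N x = 1) -> exists2 x, N x = 1 & Nd f - e < f x.
Proof.
move=> e0 [x0 x01].
have [y y1 fy] := polar_approx hN f e0.
have [fy0|fy0] := leP (f y) 0.
  have [f0|f0] := leP 0 (f x0).
    by exists x0 => //; lra.
  exists (- x0); first by rewrite (enormN hN).
  by rewrite linearN/=; lra.
have Ny0 : 0 < N y.
  rewrite lt_neqAle (enorm_ge0 hN) andbT eq_sym; apply/eqP => y0.
  by move: fy0; have [_ _ /(_ _ y0) -> _] := hN; rewrite linear0 ltxx.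
exists ((N y)^-1 *: y).
  by rewrite (enormZ hN) gtr0_norm ?invr_gt0// mulVf ?gt_eqF.
rewrite linearZ/=; apply: lt_le_trans fy _.
by rewrite ler_peMl ?invf_ge1// ltW.
Qed.

Section slopes.
Variables (c : R) (f : dual V) (g : nat -> dual V) (L t : R).
Hypotheses (c0 : 0 <= c)
  (haus : forall t, 0 <= t -> (aus_modulus N t <= (c * t `^ p)%:E)%E)
  (g0 : forall x, (g n x : R) @[n --> U] --> (0 : R))
  (hL : Nd (f + g n) @[n --> U] --> L) (ht : Nd (g n) @[n --> U] --> t).

(** The functional f + g_n is tested on x + (s/3) y, where x almost norms f and
    y is the projection to Y of u_n - u_m. The limit is taken in n first, which
    kills g_n at the fixed vectors x, u_m and e_i, and then in m, which makes
    y asymptotically equal to u_n - u_m. *)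
Lemma polar_slope_eta (s eta : R) : (exists x, N x = 1) -> 0 <= s -> 0 < eta ->
  Nd f - eta + s / 3 * (t - eta) <= L * (1 + c * s `^ p + eta).
Proof.
move=> x0 s0 eta0.
have [x x1 fx] := polar_unit_approx f eta0 x0.
have [Y hY xY] := p_AUS_ball haus x1 s0 eta0 c0.
have [d [e [th thY]]] := finite_codim_projection hY.
have [n|u uP] := @boolp.choice nat V
    (fun n v => N v <= 1 /\ Nd (g n) - eta < g n v).
  by have [v] := polar_approx hN (g n) eta0; exists v.
have ub (h : dual V) n : `|h (u n)| <= Nd h.
  apply: (le_trans (polar_ub hN _ _)); rewrite ler_piMr ?(uP n).1//.
  exact: enorm_ge0 (polar_equivalent_norm hN) _.
have ucvg (h : dual V) : exists l : R, h (u n) @[n --> U] --> l.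
  by have [l _ hl] := ultra_cvg UU (ub h); exists l.
have [l fl] := ucvg f.
have [r thr] := @boolp.choice 'I_d R (fun i r => th i (u n) @[n --> U] --> r)
    (fun i => ucvg (th i)).
(* the factor 1/3 brings y into the unit ball: u_n - u_m has norm at most 2,
   and the correction by the e_i is eventually below 1 *)
pose y m n : V := u n - u m - \sum_(i < d) th i (u n - u m) *: e i.
pose A m := \sum_(i < d) `|r i - th i (u m)| * N (e i).
pose Z m := Nd f - eta + s / 3 * (l - f (u m) -
    \sum_(i < d) (r i - th i (u m)) * f (e i) + (t - eta)).
have A0 : A m @[m --> U] --> (0 : R).
  rewrite (_ : 0 = \sum_(i < d) `|r i - r i| * N (e i)); last first.
    by rewrite big1// => i _; rewrite subrr normr0 mul0r.
  apply: cvg_sumr => i; apply: cvgMr_tmp; apply: cvg_norm.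
  by apply: cvgB; [exact: cvg_cst|exact: thr].
have Zlim : Z m @[m --> U] --> Nd f - eta + s / 3 * (t - eta).
  rewrite [X in _ --> X](_ : _ = Nd f - eta + s / 3 * (l - l -
    \sum_(i < d) (r i - r i) * f (e i) + (t - eta))); last first.
    rewrite big1 ?subrr ?subr0 ?add0r// => i _.
    by rewrite subrr mul0r.
  apply: cvgD; first exact: cvg_cst.
  apply: cvgMl_tmp; apply: cvgD; last exact: cvg_cst.
  apply: cvgB; first by apply: cvgB => //; exact: cvg_cst.
  apply: cvg_sumr => i; apply: cvgMr_tmp.
  by apply: cvgB; [exact: cvg_cst|exact: thr].
apply: (cvgr_to_le Zlim).
have : \forall m \near U, A m < 1 by exact: cvg_near_lt A0 _.
apply: filterS => m Am.
have ylim : 1 + 1 + \sum_(i < d) `|th i (u n) - th i (u m)| * N (e i) @[n --> U]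
    --> 1 + 1 + A m.
  apply: cvgD; first exact: cvg_cst.
  apply: cvg_sumr => i; apply: cvgMr_tmp; apply: cvg_norm.
  by apply: cvgB; [exact: thr|exact: cvg_cst].
have y3 : \forall n \near U, N (y m n) <= 3.
  have : 1 + 1 + A m < 3 by lra.
  move=> /(cvg_near_lt ylim); apply: filterS => n hn.
  apply: le_trans (ltW hn); rewrite /y.
  apply: (le_trans (enormB hN _ _)); apply: lerD.
    by apply: (le_trans (enormB hN _ _)); apply: lerD; exact: (uP _).1.
  apply: (le_trans (enorm_sum hN _)); apply: ler_sum => i _.
  by rewrite (enormZ hN) linearB.
pose W n : R := Nd f - eta + g n x + s / 3 * ((f (u n) - f (u m)
   - \sum_(i < d) (th i (u n) - th i (u m)) * f (e i)) +
   (Nd (g n) - eta - g n (u m)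
   - \sum_(i < d) (th i (u n) - th i (u m)) * g n (e i))).
have Wlim : W n @[n --> U] --> Z m.
  rewrite [X in _ --> X](_ : _ = Nd f - eta + 0 + s / 3 * ((l - f (u m)
   - \sum_(i < d) (r i - th i (u m)) * f (e i)) + (t - eta - 0
   - \sum_(i < d) (r i - th i (u m)) * 0))); last first.
    rewrite [X in _ - 0 - X]big1 ?subr0 ?addr0// => i _; exact: mulr0.
  have thm i : th i (u n) - th i (u m) @[n --> U] --> r i - th i (u m).
    by apply: cvgB; [exact: thr|exact: cvg_cst].
  apply: cvgD; first by apply: cvgD; [exact: cvg_cst|exact: g0].
  apply: cvgMl_tmp; apply: cvgD; apply: cvgB.
  - by apply: cvgB => //; exact: cvg_cst.
  - by apply: cvg_sumr => i; apply: cvgMr_tmp.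
  - by apply: cvgB; [apply: cvgB => //; exact: cvg_cst|exact: g0].
  - by apply: cvg_sumr => i; apply: cvgM.
have Llim : Nd (f + g n) * (1 + c * s `^ p + eta) @[n --> U] -->
    L * (1 + c * s `^ p + eta) by exact: cvgMr_tmp.
apply: (ler_cvg Wlim Llim); move: y3; apply: filterS => n y3.
have [un gu] := uP n.
have hy : N (x + s *: (3^-1 *: y m n)) <= 1 + c * s `^ p + eta.
  apply: xY; first by apply: submod_setZ; [case: hY|exact: thY].
  by rewrite (enormZ hN) ger0_norm ?invr_ge0//; lra.
have pos : 0 <= Nd (f + g n) by exact: enorm_ge0 (polar_equivalent_norm hN) _.
apply: le_trans (ler_wpM2l pos hy).
apply: le_trans (polar_ub hN _ _); apply: le_trans (ler_norm _).
rewrite scalerA linearD linearZ /=.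
have yE (h : dual V) : h (y m n) = h (u n) - h (u m) -
    \sum_(i < d) (th i (u n) - th i (u m)) * h (e i).
  rewrite /y linearB linearB/= linear_sum/=; congr (_ - _).
  by apply: eq_bigr => i _; rewrite linearZ/= linearB.
change (W n <= (f x + g n x) + s / 3 * (f (y m n) + g n (y m n))).
rewrite !yE /W; apply: lerD; first by rewrite lerD2r ltW.
apply: ler_wpM2l; first by rewrite divr_ge0.
by rewrite lerD2l lerD2r lerD2r ltW.
Qed.

Lemma polar_slope (s : R) : 0 <= s -> Nd f + s / 3 * t <= L * (1 + c * s `^ p).
Proof.
move=> s0.
have pN := polar_equivalent_norm hN.
have L0 : 0 <= L.
  by apply: (cvgr_to_ge hL); apply: filterE => n; exact: enorm_ge0 pN _.
have K0 : 0 <= c * s `^ p by rewrite mulr_ge0 ?powR_ge0.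
(* if the sphere is empty, the space is trivial *)
have [x0|x0] := pselect (exists x, N x = 1); last first.
  have pol0 (h : dual V) : Nd h = 0.
    apply/eqP; rewrite eq_le (enorm_ge0 pN) andbT.
    apply: (polar_le hN) => x _.
    have [y0|y0] := eqVneq (N x) 0.
      by have [_ _ /(_ _ y0) -> _] := hN; rewrite linear0 normr0.
    exfalso; apply: x0; exists ((N x)^-1 *: x).
    by rewrite (enormZ hN) ger0_norm ?mulVf// invr_ge0 (enorm_ge0 hN).
  have t0 : t <= 0.
    by apply: (cvgr_to_le ht); apply: filterE => n; rewrite pol0.
  rewrite pol0 add0r; apply: (@le_trans _ _ 0).
    by rewrite mulr_ge0_le0// divr_ge0.
  by rewrite mulr_ge0//; lra.
rewrite leNgt; apply/negP => lt.
set D := Nd f + s / 3 * t - L * (1 + c * s `^ p).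
have D0 : 0 < D by rewrite subr_gt0.
set K := 1 + s / 3 + L.
have s30 : 0 <= s / 3 by rewrite divr_ge0.
have Kgt0 : 0 < K by rewrite /K; lra.
have eta0 : 0 < D / (2 * K) by rewrite divr_gt0// mulr_gt0.
have := polar_slope_eta x0 s0 eta0.
set eta := D / (2 * K) in eta0 *.
have hD : eta * K = D / 2 by rewrite /eta; field; lra.
move=> h.
have : D <= eta * K by rewrite /D /K; nra.
by lra.
Qed.

End slopes.

(** The choice s = lam (t/L)^(q-1) turns both s t/L and s^p into multiples of
    (t/L)^q, because p (q - 1) = q; lam is small enough for the linear gain
    lam/3 to beat the loss c lam^p = lam/6. The bound on a/L that results is
    stronger than one on (a/L)^q, as a <= L. *)
Lemma lower_estimate_of_slopes (c k lam a t L : R) : 0 <= c -> 0 < lam ->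
  c * lam `^ p = lam / 6 -> k = lam / 6 -> 0 <= a -> 0 <= t -> 0 <= L ->
  (forall s, 0 <= s -> a + s / 3 * t <= L * (1 + c * s `^ p)) ->
  a `^ q + k * t `^ q <= L `^ q.
Proof.
move=> c0 lam0 clam -> a0 t0 L0 h.
have [q1 pqE] := conj_exponent p1 pq.
have p1' := p1.
have p0 : 0 < p by lra.
have q0 : 0 < q by lra.
have aL : a <= L.
  have := h 0 (lexx 0); rewrite !mul0r addr0 powR0 ?mulr0 ?addr0 ?mulr1//.
  by rewrite gt_eqF.
have [L0'|Lneq0] := eqVneq L 0.
  have -> : a = 0 by lra.
  have -> : t = 0.
    by have := h 3 (ler0n _ 3); rewrite L0' mul0r; lra.
  by rewrite L0' powR0 ?mulr0 ?addr0// gt_eqF.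
have Lgt0 : 0 < L by rewrite lt_neqAle eq_sym Lneq0.
set tau := t / L.
have tau0 : 0 <= tau by rewrite divr_ge0.
have tE : t = tau * L by rewrite /tau divfK.
have aE : a = a / L * L by rewrite divfK.
have al0 : 0 <= a / L by rewrite divr_ge0.
have al1 : a / L <= 1 by rewrite ler_pdivrMr// mul1r.
have := h _ (mulr_ge0 (ltW lam0) (powR_ge0 tau (q - 1))).
rewrite (powRM _ (ltW lam0) (powR_ge0 _ _)) -powRrM (mulrC (q - 1)) pqE mulrA clam.
rewrite {1}aE tE.
have -> : lam * tau `^ (q - 1) / 3 * (tau * L) = lam / 3 * tau `^ q * L.
  have <- : tau * tau `^ (q - 1) = tau `^ q by rewrite mulr_powRB1//; lra.
  by field.
rewrite -mulrDl mulrC ler_pM2l// => h1.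
have aq : (a / L) `^ q <= a / L.
  have [->|a1] := eqVneq (a / L) 0; first by rewrite powR0// gt_eqF.
  by apply: ge1r_powR; [rewrite lt_neqAle eq_sym a1 al0|exact: ltW].
rewrite aE (powRM q al0 L0) (powRM q tau0 L0) mulrA -mulrDl ler_piMl ?powR_ge0//.
by lra.
Qed.

(** This is the duality between asymptotic uniform smoothness of V and weak*
    asymptotic uniform convexity of V*, with power type q. *)
Lemma weak_star_lower_estimate : p_AUS p N ->
  exists2 k : R, 0 < k & forall (f : dual V) (g : nat -> dual V),
    (forall x, (g n x : R) @[n --> U] --> (0 : R)) ->
    forall (L t : R), Nd (f + g n) @[n --> U] --> L -> Nd (g n) @[n --> U] --> t ->
    (Nd f) `^ q + k * t `^ q <= L `^ q.
Proof.
move=> [c c0 haus].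
have pN := polar_equivalent_norm hN.
have p1' := p1.
(* chosen so that c lam^(p-1) = 1/6 *)
pose lam := (6 * c)^-1 `^ (p - 1)^-1.
have lam0 : 0 < lam by rewrite powR_gt0// invr_gt0 mulr_gt0.
have clam : c * lam `^ p = lam / 6.
  have -> : lam `^ p = lam * lam `^ (p - 1) by rewrite mulr_powRB1//; lra.
  rewrite {2}/lam -powRrM mulVf ?powRr1 ?invr_ge0 ?mulr_ge0 ?ltW//; last first.
    by rewrite subr_eq0 gt_eqF.
  by field; lra.
exists (lam / 6); first by rewrite divr_gt0.
move=> f g g0 L t hL ht.
apply: (lower_estimate_of_slopes (ltW c0) lam0 clam erefl).
- exact: enorm_ge0 pN _.
- by apply: (cvgr_to_ge ht); apply: filterE => n; exact: enorm_ge0 pN _.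
- by apply: (cvgr_to_ge hL); apply: filterE => n; exact: enorm_ge0 pN _.
- by move=> s s0; exact: (polar_slope (ltW c0) haus g0 hL ht s0).
Qed.

End lower_estimate.

(** * Lower and upper estimates along an ultrafilter *)

Section near_estimates.
Context (R : realType) (U : set_system nat) (UU : UltraFilter U).

Lemma polar_cvg (V : normedModType R) (N : V -> R) (hN : equivalent_norm N)
    (g : nat -> dual V) (B : R) : (forall n, polar N (g n) <= B) ->
  exists t : R, [/\ polar N (g n) @[n --> U] --> t, 0 <= t & t <= B].
Proof.
move=> gB; have pN := polar_equivalent_norm hN.
have [n|t _ gt] := @ultra_cvg R U UU (fun n => polar N (g n)) B.
  by rewrite ger0_norm ?enorm_ge0.
exists t; split=> //.
  by apply: (cvgr_to_ge gt); apply: filterE => n; exact: enorm_ge0.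
by apply: (cvgr_to_le gt); exact: filterE.
Qed.

Lemma weak_star_lower_near (V : normedModType R) (N : V -> R) (p q : R) :
  equivalent_norm N -> 1 < p -> p^-1 + q^-1 = 1 -> p_AUS p N ->
  exists2 k : R, 0 < k & forall (f : dual V) (g : nat -> dual V) (B eta : R),
    (forall n, polar N (g n) <= B) ->
    (forall x, (g n x : R) @[n --> U] --> (0 : R)) -> 0 < eta ->
    \forall n \near U, polar N f `^ q + k * polar N (g n) `^ q - eta
                       < polar N (f + g n) `^ q.
Proof.
move=> hN p1 pq aus; have [q1 _] := conj_exponent p1 pq.
have pN := polar_equivalent_norm hN.
have [k k0 low] := weak_star_lower_estimate hN p1 pq UU aus.
exists k => // f g B eta gB g0 eta0.
have [t [gt t0 _]] := polar_cvg hN gB.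
have fgB n : polar N (f + g n) <= polar N f + B.
  by apply: (le_trans (enormD pN _ _)); rewrite lerD2l.
have [L [fgL L0 _]] := polar_cvg hN fgB.
have h := low f g g0 L t fgL gt.
have lim : polar N f `^ q + k * polar N (g n) `^ q - polar N (f + g n) `^ q
    @[n --> U] --> polar N f `^ q + k * t `^ q - L `^ q.
  apply: cvgB; last by apply: cvg_powR => // n; exact: enorm_ge0.
  apply: cvgD; first exact: cvg_cst.
  by apply: cvgMl_tmp; apply: cvg_powR => // n; exact: enorm_ge0.
have : polar N f `^ q + k * t `^ q - L `^ q < eta by lra.
by move=> /(cvg_near_lt lim); apply: filterS => n; lra.
Qed.

(** Let f_n almost norm S + z_n, and f be the weak* limit of (f_n). The lower
    estimate in X* bounds |f|^q + k lim |f_n - f|^q by 1, and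
    (S + z_n)(f_n) is the sum of S f, of z_n (f_n - f) and of terms that tend
    to 0, among them S (f_n - f) if S is evaluation at a point of X. For S
    within d of such a point this last term is at most 2 d in the limit. *)
Lemma weak_star_upper_near (X : normedModType R) (N : X -> R) (p q : R) :
  equivalent_norm N -> 1 < p -> p^-1 + q^-1 = 1 -> p_AUS p N ->
  exists2 C : R, 0 <= C & forall B eta : R, 0 < eta ->
  exists2 d : R, 0 < d &
  forall (S : dual (dual X)) (z : nat -> dual (dual X)),
    polar (polar N) S <= B -> (forall n, polar (polar N) (z n) <= B) ->
    (forall f, (z n f : R) @[n --> U] --> (0 : R)) ->
    (exists x, polar (polar N) (S - canonical_embedding x) <= d) ->
    \forall n \near U, polar (polar N) (S + z n) `^ p <
      polar (polar N) S `^ p + C * polar (polar N) (z n) `^ p + eta.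
Proof.
move=> hN p1 pq aus; have [q1 _] := conj_exponent p1 pq.
have pN := polar_equivalent_norm hN.
have ppN := polar_equivalent_norm pN.
set Nd := polar N in pN ppN *; set Ndd := polar Nd in ppN *.
have [k k0 low] := weak_star_lower_estimate hN p1 pq UU aus.
exists (k `^ (- (p / q))); first exact: powR_ge0.
set C := k `^ _ => B eta eta0.
pose K := p * (3 * B + 1) `^ (p - 1).
have K0 : 0 <= K by rewrite mulr_ge0 ?powR_ge0//; lra.
have d0 : 0 < Num.min 3^-1 (eta / (6 * (K + 1))).
  by rewrite lt_min invr_gt0 ltr0n divr_gt0// mulr_gt0//; lra.
exists (Num.min 3^-1 (eta / (6 * (K + 1)))) => //; set d := Num.min _ _ in d0 *.
have d3 : 3 * d <= 1.
  have : d <= 3^-1 by rewrite ge_min lexx.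
  by lra.
have dK : 3 * d * K <= eta / 2.
  have : d <= eta / (6 * (K + 1)) by rewrite ge_min lexx orbT.
  by rewrite ler_pdivlMr; nra.
move=> S z SB zB z0 [x Sx].
have [n|f fP] := @boolp.choice nat (dual X)
    (fun n f => Nd f <= 1 /\ Ndd (S + z n) - d < (S + z n) f).
  by have [f] := polar_approx pN (S + z n) d0; exists f.
have [f0 f01 ff0] := weak_star_limit hN UU (fun n => (fP n).1).
rewrite -/Nd in f01.
pose g n := f n - f0.
have g0 y : (g n y : R) @[n --> U] --> (0 : R).
  rewrite -(subrr (f0 y : R)); apply: cvgB; [exact: ff0|exact: cvg_cst].
have gB n : Nd (g n) <= 2.
  apply: (le_trans (enormB pN _ _)).
  by have := (fP n).1; lra.
have [t [gt t0 t2]] := polar_cvg hN gB.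
have [L [fL L0 L1]] := polar_cvg hN (fun n => (fP n).1).
have [T [zT T0 TB]] := polar_cvg pN zB.
have SzB n : Ndd (S + z n) <= B + B.
  by apply: (le_trans (enormD ppN _ _)); rewrite lerD.
have [M [SzM M0 _]] := polar_cvg pN SzB.
have fgL : Nd (f0 + g n) @[n --> U] --> L.
  by rewrite (_ : (fun n => _) = (fun n => Nd (f n)))//;
    apply/funext => n; rewrite /g addrC subrK.
have akt : Nd f0 `^ q + k * t `^ q <= 1.
  apply: (le_trans (low f0 g g0 L t fgL gt)).
  have -> : 1 = 1 `^ q :> R by rewrite powR1.
  apply: ge0_ler_powR; rewrite ?nnegrE//; lra.
have a0 : 0 <= Nd f0 by exact: enorm_ge0.
have A0 : 0 <= Ndd S by exact: enorm_ge0.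
have hE := dual_pair_powR p1 pq k0 a0 t0 A0 T0 akt.
set a := Nd f0 in f01 a0 akt hE *; set A := Ndd S in SB A0 hE *.
(* one d comes from the choice of f_n, two from S (f_n - f) *)
have ME : M <= a * A + t * T + 3 * d.
  have lim : a * A + Nd (g n) * Ndd (z n) + 3 * d + (g n x : R) + (z n f0 : R)
      @[n --> U] --> a * A + t * T + 3 * d + 0 + 0.
    apply: cvgD; last exact: z0.
    apply: cvgD; last exact: g0.
    apply: cvgD; last exact: cvg_cst.
    by apply: cvgD; [exact: cvg_cst|exact: cvgM].
  rewrite !addr0 in lim.
  apply: (ler_cvg SzM lim); apply: filterE => n.
  have [_ hn] := fP n.
  have fE : f n = f0 + g n by rewrite /g addrC subrK.
  have SE : (S + z n) (f n) = S f0 + (S - canonical_embedding x) (g n) + g n x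
      + z n f0 + z n (g n) :> R.
    have -> : (S + z n) (f n) = S (f n) + z n (f n) by [].
    have -> : (S - canonical_embedding x) (g n) = S (g n) - g n x by [].
    have SD : S (f0 + g n) = S f0 + S (g n) :> R by exact: linearD.
    have zD : z n (f0 + g n) = z n f0 + z n (g n) :> R by exact: linearD.
    by rewrite fE SD zD; ring.
  have h1 : S f0 <= A * a by apply: le_trans (ler_norm _) _; exact: (polar_ub pN).
  have h2 : (S - canonical_embedding x) (g n) <= d * 2.
    apply: le_trans (ler_norm _) _; apply: (le_trans (polar_ub pN _ _)).
    by apply: ler_pM => //; exact: enorm_ge0.
  have h3 : z n (g n) <= Ndd (z n) * Nd (g n).
    by apply: le_trans (ler_norm _) _; exact: (polar_ub pN).
  rewrite -/Ndd; move: hn; rewrite SE.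
  set y1 : R := S f0 in h1 *; set y2 : R := (S - _) (g n) in h2 *.
  set y3 : R := z n (g n) in h3 *; set y4 : R := g n x; set y5 : R := z n f0.
  by move: h1 h2 h3; set y6 := _ * Nd (g n); rewrite (mulrC (Nd (g n))) -/y6; lra.
have E0 : 0 <= a * A + t * T by rewrite addr_ge0 ?mulr_ge0.
have EB : a * A + t * T + 3 * d <= 3 * B + 1 by nra.
have MA : M `^ p <= A `^ p + C * T `^ p + eta / 2.
  have Mle : M `^ p <= (a * A + t * T + 3 * d) `^ p.
    by apply: ge0_ler_powR; rewrite ?nnegrE//; lra.
  have d0' : 0 <= 3 * d by lra.
  have := powR_sub_le p1 E0 (_ : a * A + t * T <= a * A + t * T + 3 * d) EB.
  rewrite lerDl => /(_ d0'); rewrite -/K.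
  have -> : a * A + t * T + 3 * d - (a * A + t * T) = 3 * d by ring.
  by rewrite -/C in hE; lra.
have lim : Ndd (S + z n) `^ p - C * Ndd (z n) `^ p @[n --> U] -->
    M `^ p - C * T `^ p.
  apply: cvgB; last apply: cvgMl_tmp.
    by apply: cvg_powR => // n; exact: enorm_ge0.
  by apply: cvg_powR => // n; exact: enorm_ge0.
have : M `^ p - C * T `^ p < A `^ p + eta by lra.
by move=> /(cvg_near_lt lim); apply: filterS => n; lra.
Qed.

End near_estimates.

(** * Trees of lists that branch along an ultrafilter *)

Section trees.
Context (R : realType) (U : set_system nat) (UU : UltraFilter U).
Hypothesis Uoo : forall m, \forall n \near U, (m < n)%N.

Definition large_tree (T : set (seq nat)) :=
  T [::] /\ forall s, T s -> \forall n \near U, T (rcons s n).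

Lemma large_treeI (T T' : set (seq nat)) :
  large_tree T -> large_tree T' -> large_tree (T `&` T').
Proof.
move=> [T0 TS] [T'0 T'S]; split=> // s [Ts T's].
by apply: filterS2 (TS s Ts) (T'S s T's).
Qed.

Lemma large_tree_sorted : large_tree [set s | sorted ltn s].
Proof.
split=> // -[|x s]/= ss; first exact: filterE.
by have := Uoo (last x s); apply: filterS => n; rewrite rcons_path ss.
Qed.

Lemma large_tree_bigI n (T : 'I_n -> set (seq nat)) :
  (forall i, large_tree (T i)) -> large_tree [set s | forall i, T i s].
Proof.
move=> hT; split=> [i|s Ts]; first exact: (hT i).1.
by apply: filter_forall => i; exact: (hT i).2.
Qed.

Lemma large_tree_node (T : set (seq nat)) j : large_tree T ->
  exists2 s, T s & size s = j.
Proof.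
move=> hT; elim: j => [|j [s Ts <-]]; first by exists [::] => //; exact: hT.1.
have [m Tm] := filter_ex (hT.2 s Ts).
by exists (rcons s m) => //; rewrite size_rcons.
Qed.

(** A form of Ramsey's theorem: the constants are the iterated limits of h
    along U, and the tree keeps the nodes where each limit is almost
    attained. *)
Lemma large_tree_stable (k : nat) (h : seq nat -> R) (B e : R) : 0 < e ->
  (forall s, `|h s| <= B) ->
  exists (K : nat -> R) (T : set (seq nat)), large_tree T /\
    forall s, T s -> (size s <= k)%N -> `|h s - K (size s)| <= e.
Proof.
elim: k h B e => [|k ih] h B e e0 hB.
  exists (fun=> h [::]), setT; split; first by split=> // s _; exact: filterE.
  by move=> s _; rewrite leqn0 => /nilP ->; rewrite subrr normr0 ltW.
have e20 : 0 < e / 2 by lra.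
have [n|KT KTP] := @boolp.choice nat ((nat -> R) * set (seq nat)) (fun n KT =>
    large_tree KT.2 /\ forall s, KT.2 s -> (size s <= k)%N ->
    `|h (n :: s) - KT.1 (size s)| <= e / 2).
  have [K [T hKT]] := ih (fun s => h (n :: s)) B (e / 2) e20 (fun s => hB _).
  by exists (K, T).
have [i|K' K'P] := @boolp.choice 'I_k.+1 R (fun i l => (KT n).1 i @[n --> U] --> l).
  have [|l _ hl] := @ultra_cvg R U UU (fun n => (KT n).1 i) (B + e / 2); last by exists l.
  (* a node of length i bounds the value at i *)
  move=> n; have [hTn hT] := KTP n; have [s Ts ss] := large_tree_node i hTn.
  have := hT s Ts; rewrite ss -ltnS ltn_ord => /(_ isT).
  have := hB (n :: s); rewrite !ler_norml; lra.
exists (fun i => if i is j.+1 then K' (inord j) else h [::]).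
exists (fun s => if s is n :: s' then
  (forall i : 'I_k.+1, `|(KT n).1 i - K' i| <= e / 2) /\ (KT n).2 s' else True).
split; first split=> //.
  case=> [_|n s /= [Kn Ts]]; last first.
    have [[_ TS] _] := KTP n.
    by have := TS s Ts; apply: filterS.
  have : \forall n \near U, forall i : 'I_k.+1, `|(KT n).1 i - K' i| <= e / 2.
    apply: filter_forall => i; have /cvgrPdist_le/(_ _ e20) := K'P i.
    by apply: filterS => n; rewrite distrC.
  by apply: filterS => n Kn /=; split=> //; have [[T0 _] _] := KTP n.
case=> [_ _|n s [Kn Ts]]/=; first by rewrite subrr normr0 ltW.
rewrite ltnS => sk; have [_ hT] := KTP n.
have := hT s Ts sk; have := Kn (inord (size s)); rewrite inordK ?ltnS//.
by rewrite !ler_norml; lra.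
Qed.

(** Backward induction on the length: a node is the weak* limit of its
    successors, and lists of length k keep their value under F. *)
Lemma weak_star_tree (V : normedModType R) (N : V -> R) (hN : equivalent_norm N)
    (k : nat) (F : seq nat -> dual V) (B : R) : (forall s, polar N (F s) <= B) ->
  exists g : seq nat -> dual V, [/\ forall s, size s = k -> g s = F s,
    forall s, polar N (g s) <= B &
    forall s, (size s < k)%N -> forall x,
      (g (rcons s n) x : R) @[n --> U] --> (g s x : R)].
Proof.
elim: k F => [|k ih] F FB; first by exists F.
have [s|F' F'P] := @boolp.choice (seq nat) (dual V) (fun s f => polar N f <= B /\
    forall x, (F (rcons s n) x : R) @[n --> U] --> (f x : R)).
  by have [f fB fl] := weak_star_limit hN UU (fun n => FB (rcons s n)); exists f.
have [g [gF gB gl]] := ih F' (fun s => (F'P s).1).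
exists (fun s => if size s == k.+1 then F s else g s); split.
- by move=> s ->; rewrite eqxx.
- by move=> s; case: ifP.
- move=> s; rewrite ltnS leq_eqVlt => /predU1P[sk|sk] x.
    rewrite sk ltn_eqF// gF//.
    rewrite (_ : (fun n => _) = (fun n => F (rcons s n) x : R)); first exact: (F'P s).2.
    by apply/funext => n; rewrite size_rcons sk eqxx.
  rewrite ltn_eqF ?ltnS ?(ltnW sk)//.
  rewrite (_ : (fun n => _) = (fun n => g (rcons s n) x : R)); first exact: gl.
  by apply/funext => n; rewrite size_rcons eqSS ltn_eqF.
Qed.

End trees.

(** * Branches and their increments *)

Definition interleaved (u v : seq nat) :=
  [/\ size u = size v, forall i, (i < size u)%N -> (nth 0 u i <= nth 0 v i)%N &
     forall i, (i.+1 < size u)%N -> (nth 0 v i <= nth 0 u i.+1)%N].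

Lemma interleaved_rcons (u v : seq nat) (a b : nat) : interleaved u v ->
  all (fun x => (x < a)%N) v -> (a <= b)%N -> interleaved (rcons u a) (rcons v b).
Proof.
move=> [suv uv vu] va ab; split; first by rewrite !size_rcons suv.
- move=> i; rewrite size_rcons ltnS leq_eqVlt => /predU1P[->|iu].
    by rewrite nth_rcons ltnn eqxx nth_rcons suv ltnn eqxx.
  by rewrite !nth_rcons -suv iu uv.
- move=> i; rewrite size_rcons ltnS => iu; rewrite !nth_rcons -suv iu.
  have [iu2|iu2] := ltnP i.+1 (size u); first exact: vu.
  have -> : i.+1 == size u by rewrite eqn_leq iu iu2.
  by apply: ltnW; apply: (allP va); rewrite mem_nth// -suv.
Qed.

Lemma seq_ub (s : seq nat) : exists c, all (fun x => (x < c)%N) s.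
Proof.
elim: s => [|x s [c sc]]; first by exists 0%N.
exists (maxn x.+1 c); rewrite /= leq_max ltnSn/=.
by apply: sub_all sc => y yc; rewrite leq_max yc orbT.
Qed.

(** Pigeonhole principle: one of the L blocks of length r has a sum at most
    S/L, and this sum bounds each of its terms, as they are nonnegative. *)
Lemma small_block (R : realType) (a : nat -> R) (L r : nat) (S : R) : (0 < L)%N ->
  (forall i, (i < L * r)%N -> 0 <= a i) -> \sum_(0 <= i < L * r) a i <= S ->
  exists2 l, (l < L)%N & forall i, (l * r <= i < l * r + r)%N -> a i <= S / L%:R.
Proof.
move=> L0 a0 aS; apply: contrapT => h.
have Lr : 0 < L%:R :> R by rewrite ltr0n.
suff : S < \sum_(0 <= i < L * r) a i by rewrite ltNge aS.
have -> : S = \sum_(l < L) (S / L%:R).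
  by rewrite sumr_const card_ord -[RHS]mulr_natr divfK// gt_eqF.
rewrite big_nat_mul/= -(big_mkord xpredT (fun=> S / L%:R)) .
apply: ltr_sum_nat => // l /= lL; rewrite ltNge; apply/negP => bl; apply: h.
exists l => // i /andP[li il]; apply: le_trans bl.
have il' : (i < l.+1 * r)%N by rewrite mulSn addnC.
have lLr : (l.+1 * r <= L * r)%N by rewrite leq_mul2r lL orbT.
rewrite (big_cat_nat li (ltnW il'))/= (big_ltn il')/=.
have p1 : 0 <= \sum_(l * r <= j < i) a j.
  rewrite big_nat_cond; apply: sumr_ge0 => j /andP[/andP[_ ji] _]; apply: a0.
  by rewrite (leq_trans _ lLr)// (ltn_trans ji).
have p2 : 0 <= \sum_(i.+1 <= j < l.+1 * r) a j.
  rewrite big_nat_cond; apply: sumr_ge0 => j /andP[/andP[_ jl] _]; apply: a0.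
  by rewrite (leq_trans jl).
by lra.
Qed.

Section branches.
Context (R : realType) (U : set_system nat) (UU : UltraFilter U).
Hypothesis Uoo : forall m, \forall n \near U, (m < n)%N.
Context (V : normedModType R) (k : nat) (g : seq nat -> dual V) (T : set (seq nat)).
Hypotheses (hT : large_tree U T)
  (gl : forall s, (size s < k)%N -> forall x,
      (g (rcons s n) x : R) @[n --> U] --> (g s x : R)).

(** The root gets 0, being its own prefix. *)
Definition increment (s : seq nat) : dual V := g s - g (take (size s).-1 s).

Lemma increment_rcons s n : increment (rcons s n) = g (rcons s n) - g s.
Proof. by rewrite /increment size_rcons/= -cats1 take_size_cat. Qed.

Lemma increment_weak_star_null s : (size s < k)%N ->
  forall x, (increment (rcons s n) x : R) @[n --> U] --> (0 : R).
Proof.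
move=> sk x.
rewrite (_ : (fun n => _) = (fun n => g (rcons s n) x - g s x : R)); last first.
  by apply/funext => n; rewrite increment_rcons.
by rewrite -(subrr (g s x : R)); apply: cvgB; [exact: gl|exact: cvg_cst].
Qed.

Section interleaved_branch.
Context (N : dual V -> R) (B p K0 : R) (K : nat -> R) (e : R).
Hypotheses (hN : equivalent_norm N) (gB : forall s, N (g s) <= B) (e0 : 0 < e)
  (k0 : 0 < K0)
  (low : forall (f : dual V) (z : nat -> dual V) (B eta : R),
    (forall n, N (z n) <= B) ->
    (forall x, (z n x : R) @[n --> U] --> (0 : R)) -> 0 < eta ->
    \forall n \near U, N f `^ p + K0 * N (z n) `^ p - eta < N (f + z n) `^ p)
  (hK : forall s, T s -> (size s <= k)%N ->
    `|N (increment s) `^ p - K (size s)| <= e).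

(** The two branches are lengthened alternately. Lengthening u gains the next
    K, by the lower estimate; lengthening v loses nothing but e, by the same
    estimate without its second term. *)
Lemma interleaved_branch j : (j <= k)%N -> exists u v,
  [/\ T u, T v, size u = j, interleaved u v &
    K0 * \sum_(0 <= i < j) (K i.+1 - e) - 2 * e * j%:R <= N (g u - g v) `^ p].
Proof.
have := e0; have := k0 => k0' e0'.
have iB s : N (increment s) <= B + B.
  by apply: (le_trans (enormB hN _ _)); rewrite lerD.
elim: j => [_|j ih jk].
  exists [::], [::]; split=> //; try exact: hT.1.
  by rewrite big_geq// mulr0 mulr0 subr0 powR_ge0.
have [u [v [Tu Tv uj uv huv]]] := ih (ltnW jk).
have vj : size v = j by case: uv => <-.
have [c vc] := seq_ub v.
have low1 := low (g u - g v) (fun n => iB (rcons u n))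
  (increment_weak_star_null (eq_ind_r (fun i => i < k)%N jk uj)) e0.
have [a [[Tua ha] ca]] := filter_ex (filterI (filterI (hT.2 u Tu) low1) (Uoo c)).
have neg x : (- increment (rcons v n) : dual V) x @[n --> U] --> (0 : R).
  rewrite -[X in _ --> X]oppr0; apply: cvgN.
  by apply: increment_weak_star_null; rewrite vj.
have nB n : N (- increment (rcons v n)) <= B + B by rewrite (enormN hN).
have low2 := low (g (rcons u a) - g v) nB neg e0.
have [b [[Tvb hb] ab]] := filter_ex (filterI (filterI (hT.2 v Tv) low2) (Uoo a)).
exists (rcons u a), (rcons v b); split => //.
- by rewrite size_rcons uj.
- apply: interleaved_rcons => //; last exact: ltnW.
  by apply: sub_all vc => x xc; exact: ltn_trans xc ca.
- have hKu := hK Tua; rewrite size_rcons uj in hKu.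
  have {}hKu := hKu jk.
  have E1 : g u - g v + increment (rcons u a) = g (rcons u a) - g v.
    by rewrite increment_rcons [LHS]addrC addrA subrK.
  have E2 : g (rcons u a) - g v - increment (rcons v b) = g (rcons u a) - g (rcons v b).
    by rewrite increment_rcons opprB addrA subrK.
  rewrite E1 in ha; rewrite E2 in hb.
  have pos : 0 <= K0 * N (- increment (rcons v b)) `^ p.
    by rewrite mulr_ge0 ?powR_ge0// ltW.
  rewrite big_nat_recr//= mulrDr -natr1.
  have : K0 * (K j.+1 - e) <= K0 * N (increment (rcons u a)) `^ p.
    by apply: ler_wpM2l; [exact: ltW|move: hKu; rewrite ler_norml; lra].
  by move: huv ha hb; lra.
Qed.

End interleaved_branch.

(** Triangle inequality over m successive levels. The new elements can be taken
    above any c, as the tree branches along a nonprincipal ultrafilter. *)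
Lemma block_branch (N : dual V -> R) (hN : equivalent_norm N) (c0 : R) (c m : nat) u :
  T u -> (forall s, T s -> (size u < size s <= size u + m)%N ->
    N (increment s) <= c0) ->
  exists w, [/\ size w = m, T (u ++ w), all (fun x => (c <= x)%N) w &
    N (g (u ++ w) - g u) <= m%:R * c0].
Proof.
move=> Tu; elim: m => [|m ih] hinc.
  by exists [::]; rewrite cats0 subrr (enorm0 hN) mul0r.
have [|w [wm Tw wc hw]] := ih.
  by move=> s Ts /andP[h1 h2]; apply: hinc; rewrite // h1 addnS ltnW// ltnS.
have [a [Ta ca]] := filter_ex (filterI (hT.2 _ Tw) (Uoo c)).
exists (rcons w a); rewrite size_rcons wm -rcons_cat all_rcons wc ltnW//; split=> //.
have hi := hinc _ Ta; rewrite size_rcons size_cat wm in hi.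
have {}hi : N (increment (rcons (u ++ w) a)) <= c0.
  by apply: hi; rewrite ltnS leq_addr addnS leqnn.
have -> : g (rcons (u ++ w) a) - g u = (g (u ++ w) - g u) + increment (rcons (u ++ w) a).
  by rewrite increment_rcons [RHS]addrC addrA subrK.
by apply: (le_trans (enormD hN _ _)); rewrite -natr1 mulrDl mul1r lerD.
Qed.

End branches.

Section common_branch.
Context (R : realType) (U : set_system nat) (UU : UltraFilter U).
Hypothesis Uoo : forall m, \forall n \near U, (m < n)%N.

(** The same integers are appended to both branches, so that at each step
    g u - g v stays near the image of X and moves by a difference of two
    increments, to which the upper estimate applies. The factor 2^p comes from
    this difference. *)
Lemma common_branch (X : normedModType R) (k : nat)
    (g : seq nat -> dual (dual X)) (T : set (seq nat)) (N : dual (dual X) -> R)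
    (B p C d eta : R) (b : nat -> R) :
  large_tree U T ->
  (forall s, (size s < k)%N -> forall x,
      (g (rcons s n) x : R) @[n --> U] --> (g s x : R)) ->
  equivalent_norm N -> 0 < p -> 0 <= C -> (forall s, N (g s) <= B) ->
  (forall (S : dual (dual X)) (z : nat -> dual (dual X)),
    N S <= 4 * B -> (forall n, N (z n) <= 4 * B) ->
    (forall f, (z n f : R) @[n --> U] --> (0 : R)) ->
    (exists x, N (S - canonical_embedding x) <= d) ->
    \forall n \near U, N (S + z n) `^ p < N S `^ p + C * N (z n) `^ p + eta) ->
  (forall u v, T u -> T v -> size u = size v -> (size u <= k)%N ->
    exists x, N (g u - g v - canonical_embedding x) <= d) ->
  (forall s, T s -> (size s <= k)%N -> N (increment g s) `^ p <= b (size s)) ->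
  forall (c m : nat) u v, T u -> T v -> size u = size v -> (size u + m <= k)%N ->
  exists w, [/\ size w = m, T (u ++ w), T (v ++ w), all (fun x => (c <= x)%N) w &
    N (g (u ++ w) - g (v ++ w)) `^ p <= N (g u - g v) `^ p +
      \sum_(size u <= i < size u + m) (C * (2 `^ p * b i.+1) + eta)].
Proof.
move=> hT gl hN p0 C0 gB up near hb c m u v Tu Tv suv.
have B0 : 0 <= B by apply: le_trans (gB [::]); exact: enorm_ge0.
elim: m => [_|m ih uk].
  by exists [::]; rewrite !cats0 addn0 big_geq// addr0; split.
have [|w [wm Tuw Tvw wc hw]] := ih; first by rewrite (leq_trans _ uk)// addnS.
set u' := u ++ w in Tuw hw *; set v' := v ++ w in Tvw hw *.
have su' : size u' = (size u + m)%N by rewrite size_cat wm.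
have sv' : size v' = (size u + m)%N by rewrite size_cat wm suv.
have sk : (size u + m < k)%N by rewrite -addnS.
pose z n := increment g (rcons u' n) - increment g (rcons v' n).
have iB s : N (increment g s) <= B + B.
  by apply: (le_trans (enormB hN _ _)); rewrite lerD.
have SB : N (g u' - g v') <= 4 * B.
  apply: (le_trans (enormB hN _ _)).
  by have := gB u'; have := gB v'; lra.
have zB n : N (z n) <= 4 * B.
  apply: (le_trans (enormB hN _ _)).
  by have := iB (rcons u' n); have := iB (rcons v' n); lra.
have z0 f : (z n f : R) @[n --> U] --> (0 : R).
  rewrite -[X in _ --> X](subrr 0).
  by apply: cvgB; apply: (increment_weak_star_null UU gl); rewrite ?su' ?sv'.
have nx : exists x, N (g u' - g v' - canonical_embedding x) <= d.
  by apply: near; rewrite ?su' ?sv'// ltnW.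
have step := up _ z SB zB z0 nx.
have [a [[[Tua Tva] ha] ca]] :=
  filter_ex (filterI (filterI (filterI (hT.2 _ Tuw) (hT.2 _ Tvw)) step) (Uoo c)).
exists (rcons w a); rewrite size_rcons wm -!rcons_cat all_rcons wc ltnW//; split=> //.
have E : g u' - g v' + z a = g (rcons u' a) - g (rcons v' a).
  rewrite /z !increment_rcons opprB addrACA (addrC (g u')) subrK.
  by rewrite addKr.
rewrite E in ha.
have bu := hb _ Tua; have bv := hb _ Tva.
rewrite size_rcons su' in bu; rewrite size_rcons sv' in bv.
have zb : N (z a) `^ p <= 2 `^ p * b (size u + m).+1.
  apply: (@le_trans _ _ ((N (increment g (rcons u' a)) +
      N (increment g (rcons v' a))) `^ p)).
    apply: ge0_ler_powR; rewrite ?nnegrE ?addr_ge0 ?(enorm_ge0 hN)//.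
      exact: ltW.
    exact: enormB.
  by apply: powR_add_le; rewrite ?(enorm_ge0 hN)//; [exact: bu|exact: bv].
rewrite addnS big_nat_recr ?leq_addr//=.
have : C * N (z a) `^ p <= C * (2 `^ p * b (size u + m).+1) by rewrite ler_wpM2l.
by move: ha hw; lra.
Qed.

End common_branch.

(** * Quasi-reflexivity *)

Section near_canonical.
Context (R : realType) (X : normedModType R).

Lemma canonical_embedding_linear (a : R) (x y : X) :
  canonical_embedding (a *: x + y) = a *: canonical_embedding x + canonical_embedding y.
Proof. by apply: dualP => f; rewrite /= linearP. Qed.

(** The functionals are the coordinates of a projection to the closure of the
    range of the canonical embedding. The closure has finite codimension as it
    contains this range. *)
Lemma quasi_reflexive_near : quasi_reflexive X ->
  exists (n : nat) (th : 'I_n -> dual (dual (dual X))),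
    forall d : R, 0 < d -> exists2 e : R, 0 < e &
      forall S, (forall i, `|th i S| <= e) ->
        exists x : X, `|S - canonical_embedding x| <= d.
Proof.
move=> [n0 [e0 cod]].
pose Y : set (dual (dual X)) :=
  [set v | forall e : R, 0 < e -> exists x : X, `|v - canonical_embedding x| < e].
have YJ x : Y (canonical_embedding x).
  by move=> e e0'; exists x; rewrite subrr normr0.
have hY : closed_finite_codimensional_subspace Y.
  split.
  - apply: submod_set_intro.
      have <- : canonical_embedding (0 : X) = 0.
        by apply: dualP => f; rewrite /= linear0.
      exact: YJ.
    move=> a u v Yu Yv e e0'.
    have a1 : 0 < `|a| + 1 by rewrite ltr_wpDl.
    have d1 : 0 < e / 2 / (`|a| + 1) by rewrite !divr_gt0.
    have [x xu] := Yu _ d1; have [y yv] := Yv (e / 2) (divr_gt0 e0' (ltr0n _ 2)).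
    exists (a *: x + y); rewrite canonical_embedding_linear.
    have -> : a *: u + v - (a *: canonical_embedding x + canonical_embedding y)
       = a *: (u - canonical_embedding x) + (v - canonical_embedding y).
      by rewrite opprD addrACA scalerBr.
    apply: (le_lt_trans (ler_normD _ _)); rewrite normrZ.
    have : `|u - canonical_embedding x| * (`|a| + 1) < e / 2.
      by rewrite -ltr_pdivlMr.
    by have := normr_ge0 (u - canonical_embedding x); lra.
  - move=> v clv e e0'.
    have e2 : 0 < e / 2 by rewrite divr_gt0.
    have /clv[w [/= Yw vw]] : nbhs v (ball v (e / 2)) by exact: nbhsx_ballx.
    have [x wx] := Yw _ e2; exists x.
    rewrite -ball_normE/= in vw.
    rewrite -(subrK w v) -addrA (le_lt_trans (ler_normD _ _))//; lra.
  - exists n0, e0 => v; have [a [x _ hx]] := cod v; exists a.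
    by rewrite -hx; exact: YJ.
have [n [e [th thY]]] := finite_codim_projection hY.
exists n, th => d d0.
set s := \sum_(i < n) `|e i|.
have s0 : 0 <= s by apply: sumr_ge0.
have eps0 : 0 < d / 2 / (s + 1) by rewrite !divr_gt0//; lra.
exists (d / 2 / (s + 1)) => // S Sth.
have [x hx] := thY S _ (divr_gt0 d0 (ltr0n _ 2)).
exists x.
rewrite -(subrK (\sum_(i < n) th i S *: e i) S) addrAC.
apply: (le_trans (ler_normD _ _)).
have : `|\sum_(i < n) th i S *: e i| <= d / 2.
  apply: (@le_trans _ _ (d / 2 / (s + 1) * s)).
    rewrite mulr_sumr (le_trans (ler_norm_sum _ _ _))// ler_sum// => i _.
    by rewrite normrZ ler_wpM2r.
  by rewrite mulrAC ler_pdivrMr; nra.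
by lra.
Qed.

End near_canonical.

(** * Images of distant subsets at bounded distance *)

(** The constant G does not depend on r, while the count in the conclusion puts
    the two subsets at distance at least r in the graph. *)
Lemma nonconcentration (R : realType) (X : normedModType R) (p q : R) : quasi_reflexive X ->
  1 < p -> p^-1 + q^-1 = 1 -> p_AUS_renormable X p ->
  p_AUS_renormable (dual X) q ->
  forall om : R, 0 <= om -> exists G : R, forall r : nat, (0 < r)%N ->
  exists2 k : nat, (0 < k)%N & forall (F : seq nat -> dual (dual X)) (B : R),
    (forall s, `|F s| <= B) ->
    (forall u v, sorted ltn u -> sorted ltn v -> size u = k -> interleaved u v ->
       `|F u - F v| <= om) ->
    exists u v c, [/\ sorted ltn u, sorted ltn v, size u = k, size v = k &
      `|F u - F v| <= G /\
      (count (fun x => x < c)%N v + r <= count (fun x => x < c)%N u)%N].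
Proof.
move=> qr p1 pq [N hN ausN] [M hM ausM] om om0.
have p0 : 0 < p by lra.
have [q1 _] := conj_exponent p1 pq.
have qp : q^-1 + p^-1 = 1 by lra.
have [U UU Uoo] := nonprincipal_ultrafilter.
have hNd := polar_equivalent_norm hN.
have hNdd := polar_equivalent_norm hNd.
have hMd := polar_equivalent_norm hM.
have [K0 K00 low] := weak_star_lower_near UU hM q1 qp ausM.
have [C C0 up] := weak_star_upper_near UU hN p1 pq ausN.
set Ndd := polar (polar N) in hNdd up; set Md := polar M in hMd low.
have [_ _ _ [c1 [C1 [c10 C10 cM]]]] := hMd.
have [_ _ _ [c2 [C2 [c20 C20 cN]]]] := hNdd.
have [n [th thP]] := quasi_reflexive_near qr.
pose D := C2 / c1.
have D0 : 0 < D by rewrite divr_gt0.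
have ND x : Ndd x <= D * Md x.
  have /andP[_ h1] := cN x; have /andP[h2 _] := cM x; apply: (le_trans h1).
  rewrite /D mulrAC ler_pdivlMr// -mulrA.
  by apply: ler_wpM2l; [exact: ltW|rewrite mulrC].
have Dp0 : 0 < D `^ p by rewrite powR_gt0.
(* S0 bounds the sum of the p-th powers of the increments, G the p-th power of
   the final distance, both in the dual norms *)
pose S0 := ((C1 * om) `^ p + 2) / K0 + 2.
have S00 : 0 < S0.
  by rewrite ltr_wpDl// divr_ge0 ?addr_ge0 ?powR_ge0// ltW.
pose G := 2 `^ p + C * 2 `^ p * (D `^ p * S0) + 1.
have G0 : 0 <= G.
  by rewrite !addr_ge0 ?mulr_ge0 ?powR_ge0// ltW.
exists (G `^ p^-1 / c2) => r r0.
have rr : 0 < r%:R :> R by rewrite ltr0n.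
(* the number of blocks is such that the small one has increments below 1/r *)
have [L' L'P] : exists L : nat, D `^ p * S0 * r%:R `^ p <= L%:R.
  exists (Num.trunc (D `^ p * S0 * r%:R `^ p)).+1.
  by apply: ltW; rewrite truncnS_gt.
pose L := L'.+1; pose k := (L * r)%N.
have k0 : (0 < k)%N by rewrite muln_gt0.
have kR : 0 < k%:R :> R by rewrite ltr0n.
exists k => // F B FB Fom.
have B0 : 0 <= B by apply: le_trans (FB [::]).
pose e1 := (k%:R : R)^-1.
have e10 : 0 < e1 by rewrite invr_gt0.
have [d d0 upd] := up (4 * (D * (C1 * B))) e1 e10.
have dC : 0 < d / C2 by rewrite divr_gt0.
have [e2 e20 nearP] := thP (d / C2) dC.
have e0 : 0 < Num.min e1 (e2 / 2) by rewrite lt_min e10 divr_gt0.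
set e := Num.min e1 (e2 / 2) in e0.
have ee1 : e <= e1 by rewrite ge_min lexx.
have ee2 : e <= e2 / 2 by rewrite ge_min lexx orbT.
have FMd s : Md (F s) <= C1 * B.
  by have /andP[_ h] := cM (F s); apply: (le_trans h); rewrite ler_wpM2l// ltW.
have [g [gF gMd gl]] := weak_star_tree UU hM k FMd.
rewrite -/Md in gMd.
have iMd s : Md (increment g s) <= C1 * B + C1 * B.
  by apply: (le_trans (enormB hMd _ _)); rewrite lerD.
have CB0 : 0 <= C1 * B + C1 * B by rewrite addr_ge0// mulr_ge0// ltW.
have [|K [T1 [hT1 KT1]]] := @large_tree_stable R U UU k
    (fun s => Md (increment g s) `^ p) ((C1 * B + C1 * B) `^ p) e e0.
  move=> s; rewrite ger0_norm ?powR_ge0//.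
  by apply: ge0_ler_powR; rewrite ?nnegrE ?(enorm_ge0 hMd)// ltW.
have [i|KT KTP] := @boolp.choice 'I_n ((nat -> R) * set (seq nat)) (fun i KT =>
    large_tree U KT.2 /\ forall s, KT.2 s -> (size s <= k)%N ->
    `|th i (g s) - KT.1 (size s)| <= e).
  have [|K' [T' hT']] := @large_tree_stable R U UU k
    (fun s => th i (g s)) (dual_norm (th i) * (c1^-1 * (C1 * B))) e e0.
    move=> s; apply: (le_trans (dual_norm_ub _ _)).
    apply: ler_wpM2l; first exact: dual_norm_ge0.
    rewrite mulrC ler_pdivlMr// mulrC; have /andP[h _] := cM (g s).
    exact: le_trans h (gMd s).
  by exists (K', T').
(* on T the lists are increasing, and the p-th powers of the increments and the
   coordinates modulo X depend, up to e, on the length only *)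
pose T := [set s | sorted ltn s] `&` T1 `&` [set s | forall i, (KT i).2 s].
have hT : large_tree U T.
  apply: large_treeI; last by apply: large_tree_bigI => i; exact: (KTP i).1.
  by apply: large_treeI => //; exact: large_tree_sorted.
have Tsort s : T s -> sorted ltn s by case=> -[].
have TK s : T s -> (size s <= k)%N -> `|Md (increment g s) `^ p - K (size s)| <= e.
  by case=> -[_ h] _; exact: KT1.
have Tnear u v : T u -> T v -> size u = size v -> (size u <= k)%N ->
    exists x, Ndd (g u - g v - canonical_embedding x) <= d.
  move=> [_ Tu] [_ Tv] suv uk.
  have [i|x hx] := nearP (g u - g v).
    have /= := (KTP i).2 u (Tu i) uk.
    have := (KTP i).2 v (Tv i); rewrite -suv => /(_ uk).
    rewrite linearB/= !ler_norml; lra.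
  exists x; have /andP[_ h] := cN (g u - g v - canonical_embedding x).
  by apply: (le_trans h); rewrite mulrC -ler_pdivlMr.
have ke : k%:R * e <= 1.
  apply: (@le_trans _ _ (k%:R * e1)); first by rewrite ler_wpM2l// ltW.
  by rewrite /e1 divff// gt_eqF.
have Kpos i : (i < k)%N -> 0 <= K i.+1 + e.
  move=> ik; have [s Ts si] := large_tree_node UU i.+1 hT.
  have := TK s Ts; rewrite si => /(_ ik).
  by have := powR_ge0 (Md (increment g s)) p; rewrite ler_norml; lra.
have SK : \sum_(0 <= i < k) (K i.+1 + e) <= S0.
  have [u [v [Tu Tv uk uv]]] := interleaved_branch UU Uoo hT gl hMd gMd e0 K00
    low TK (leqnn k).
  have vk : size v = k by case: uv => <-.
  rewrite !gF// => h.
  have hM1 : Md (F u - F v) `^ p <= (C1 * om) `^ p.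
    have h0 := enorm_ge0 hMd (F u - F v).
    apply: ge0_ler_powR; rewrite ?nnegrE//; first exact: ltW.
      by rewrite mulr_ge0// ltW.
    have /andP[_ h1] := cM (F u - F v); apply: (le_trans h1).
    by apply: ler_wpM2l; [exact: ltW|apply: Fom => //; exact: Tsort].
  have -> : \sum_(0 <= i < k) (K i.+1 + e) =
      \sum_(0 <= i < k) (K i.+1 - e) + 2 * (k%:R * e).
    have -> : 2 * (k%:R * e) = \sum_(0 <= i < k) (2 * e).
      by rewrite sumr_const_nat subn0 -[RHS]mulr_natr; ring.
    by rewrite -big_split/=; apply: eq_bigr => i _; ring.
  rewrite /S0 lerD//; last by lra.
  by rewrite ler_pdivlMr// mulrC; lra.
pose b i := D `^ p * (K i + e).
have TNb s : T s -> (size s <= k)%N -> Ndd (increment g s) `^ p <= b (size s).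
  move=> Ts sk; have h0 := enorm_ge0 hMd (increment g s).
  apply: (@le_trans _ _ ((D * Md (increment g s)) `^ p)).
    apply: ge0_ler_powR; rewrite ?nnegrE//; first exact: ltW.
    - exact: enorm_ge0.
    - by rewrite mulr_ge0// ltW.
  rewrite (powRM _ (ltW D0) h0); apply: ler_wpM2l; first exact: powR_ge0.
  by have := TK s Ts sk; rewrite ler_norml; lra.
have [l lL lsmall] := small_block (ltn0Sn L') Kpos SK.
have lk : (l * r + r <= k)%N by rewrite addnC -mulSn leq_mul2r lL orbT.
have Tsmall s : T s -> (l * r < size s <= l * r + r)%N ->
    Ndd (increment g s) <= r%:R^-1.
  move=> Ts /andP[ls sl].
  apply: (powR_le_inv p0); rewrite ?invr_ge0 ?(enorm_ge0 hNdd)//.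
  apply: (le_trans (TNb s Ts (leq_trans sl lk))); rewrite /b.
  have sS : size s = (size s).-1.+1 by rewrite prednK// (leq_ltn_trans _ ls).
  have := lsmall (size s).-1; rewrite -ltnS -sS ls sl => /(_ isT).
  move=> h; apply: (@le_trans _ _ (D `^ p * (S0 / L%:R))).
    by rewrite ler_wpM2l// ltW.
  rewrite -(powR_inv1 (ltW rr)) -powRrM mulN1r powRN.
  rewrite mulrA ler_pdivrMr ?ltr0n// [leRHS]mulrC ler_pdivlMr ?powR_gt0//.
  by apply: (le_trans L'P); rewrite ler_nat.
(* u0 is the common part before the block; the elements of wu are below c, those
   of wv and of the common continuation w are not *)
have [u0 Tu0 su0] := large_tree_node UU (l * r) hT.
rewrite -su0 in Tsmall.
have [wu [swu Twu _ hwu]] := block_branch UU Uoo hT hNdd 0 Tu0 Tsmall.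
have [c uc] := seq_ub (u0 ++ wu).
have [wv [swv Twv wvc hwv]] := block_branch UU Uoo hT hNdd c Tu0 Tsmall.
have gN s : Ndd (g s) <= D * (C1 * B).
  by apply: (le_trans (ND _)); apply: ler_wpM2l; [exact: ltW|exact: gMd].
have suv : size (u0 ++ wu) = size (u0 ++ wv) by rewrite !size_cat swu swv.
have sul : size (u0 ++ wu) = (l * r + r)%N by rewrite size_cat su0 swu.
have [|w [sw Tu Tv wc hw]] := common_branch UU Uoo hT gl hNdd p0 C0 gN upd Tnear TNb c
  (m := k - (l * r + r)) Twu Twv suv.
  by rewrite sul subnKC.
have uk : size ((u0 ++ wu) ++ w) = k by rewrite size_cat sul sw subnKC.
have vk : size ((u0 ++ wv) ++ w) = k by rewrite size_cat -suv sul sw subnKC.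
exists ((u0 ++ wu) ++ w), ((u0 ++ wv) ++ w), c.
split=> //; try exact: Tsort.
have none s : all (fun x => (c <= x)%N) s -> count (fun x => (x < c)%N) s = 0%N.
  move=> sc; apply/eqP; rewrite -leqn0 leqNgt -has_count -all_predC.
  by apply: sub_all sc => x /=; rewrite leqNgt.
split; last first.
  rewrite !(count_cat _ _ w) (none w wc) !addn0.
  move: uc; rewrite all_count => /eqP ->.
  by rewrite count_cat (none wv wvc) addn0 size_cat swu leq_add2r count_size.
have rV : r%:R * r%:R^-1 = 1 :> R by rewrite divff// gt_eqF.
rewrite rV in hwu hwv.
have start : Ndd (g (u0 ++ wu) - g (u0 ++ wv)) `^ p <= 2 `^ p.
  apply: ge0_ler_powR; rewrite ?nnegrE ?(enorm_ge0 hNdd)//; first exact: ltW.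
  have -> : g (u0 ++ wu) - g (u0 ++ wv) = (g (u0 ++ wu) - g u0) - (g (u0 ++ wv) - g u0).
    by rewrite opprB addrA subrK.
  apply: (le_trans (enormB hNdd _ _)); have -> : 2 = 1 + 1 :> R by ring.
  exact: (lerD hwu hwv).
have tail : \sum_(size (u0 ++ wu) <= i < size (u0 ++ wu) + (k - (l * r + r)))
    (C * (2 `^ p * b i.+1) + e1) <= C * 2 `^ p * (D `^ p * S0) + 1.
  rewrite sul subnKC//.
  apply: (@le_trans _ _ (\sum_(0 <= i < k) (C * (2 `^ p * b i.+1) + e1))).
    rewrite [leRHS](big_cat_nat _ lk)//= lerDr big_nat_cond.
    apply: sumr_ge0 => i /andP[/andP[_ il] _].
    rewrite addr_ge0 ?(ltW e10)// !mulr_ge0 ?powR_ge0//.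
    by apply: Kpos; exact: leq_trans lk.
  rewrite big_split/= sumr_const_nat subn0 -[e1 *+ k]mulr_natr mulVf ?gt_eqF//.
  rewrite lerD2r -mulr_sumr -mulr_sumr mulrA ler_wpM2l ?mulr_ge0 ?powR_ge0//.
  by rewrite -mulr_sumr ler_wpM2l ?powR_ge0.
rewrite (gF _ uk) (gF _ vk) in hw.
have fin : Ndd (F ((u0 ++ wu) ++ w) - F ((u0 ++ wv) ++ w)) `^ p <= G.
  by apply: (le_trans hw); rewrite /G -addrA; exact: (lerD start tail).
set z := F _ - F _ in fin *.
rewrite ler_pdivlMr// mulrC.
have /andP[h _] := cN z; apply: (le_trans h).
apply: (powR_le_inv p0); rewrite ?powR_ge0 ?(enorm_ge0 hNdd)//.
by rewrite -powRrM mulVf ?powRr1// gt_eqF.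
Qed.


(** * The interlaced graphs *)

Lemma interleaved_shift (s : seq nat) (a : nat) : sorted ltn s ->
  all (fun x => (x < a)%N) s -> (0 < size s)%N -> interleaved s (rcons (behead s) a).
Proof.
move=> ss sa s0; split.
- by rewrite size_rcons size_behead prednK.
- move=> i si; rewrite nth_rcons size_behead nth_behead.
  have [is1|is1] := ltnP i (size s).-1.
    apply: ltnW; apply: (@sorted_ltn_nth _ ltn ltn_trans 0%N _ ss i i.+1) => //.
    by rewrite inE -ltn_predRL.
  have -> : i == (size s).-1 by rewrite eqn_leq is1 -ltnS prednK// si.
  by apply: ltnW; apply: (allP sa); exact: mem_nth.
- move=> i si; rewrite nth_rcons size_behead nth_behead.
  by rewrite -ltn_predRL in si; rewrite si.
Qed.

Lemma count_lt_le (c : nat) (s t : seq nat) : (size s <= size t)%N ->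
  (forall i, (i < size s)%N -> (nth 0 t i <= nth 0 s i)%N) ->
  (count (fun x => x < c)%N s <= count (fun x => x < c)%N t)%N.
Proof.
elim: s t => [|x s ih] [|y t]//= st h; apply: leq_add.
  by case: (ltnP x c) => // xc; rewrite (leq_ltn_trans (h 0%N _)).
by apply: ih => // i si; exact: (h i.+1).
Qed.

Lemma interleaved_count (c : nat) (u v : seq nat) : interleaved u v ->
  (count (fun x => x < c)%N v <= count (fun x => x < c)%N u)%N /\
  (count (fun x => x < c)%N u <= (count (fun x => x < c)%N v).+1)%N.
Proof.
move=> [suv uv vu]; split.
  by apply: count_lt_le => [|i iv]; rewrite -?suv//; apply: uv; rewrite suv.
case: u suv uv vu => [//|x u] /= suv uv vu.
rewrite -[X in (_ <= X)%N]add1n; apply: leq_add; first by case: (x < c)%N.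
by apply: count_lt_le => [|i iu]; [rewrite -suv|exact: vu].
Qed.

Section graph.
Context (R : realType) (k : nat).
Implicit Types x y : interlaced_graph R k.

Definition elements x : seq nat := val (val x).

Lemma elements_sorted x : sorted ltn (elements x).
Proof. exact: (svalP x). Qed.

Lemma size_elements x : size (elements x) = k.
Proof. exact: size_tuple. Qed.

Lemma elements_surj s : sorted ltn s -> size s = k -> exists x, elements x = s.
Proof.
move=> ss /eqP sk; exists (exist _ (Tuple sk) ss : interlaced_graph R k).
by [].
Qed.

Lemma elements_inj : injective elements.
Proof. by move=> x y /val_inj/val_inj. Qed.

Lemma interlacedP x y : reflect (interleaved (elements x) (elements y)) (interlaced x y).
Proof.
apply: (iffP andP) => [[/forallP h1 /forallP h2]|[_ h1 h2]].
  split; rewrite ?size_elements// => i ik.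
    by have := h1 (Ordinal ik); rewrite !(tnth_nth 0%N).
  have := h2 (Ordinal (ltnW ik)) => /forallP/(_ (Ordinal ik))/implyP.
  by rewrite !(tnth_nth 0%N) eqxx; apply.
split; apply/forallP => i.
  by rewrite !(tnth_nth 0%N); apply: h1; rewrite size_elements.
apply/forallP => j; apply/implyP => /eqP ji.
by rewrite !(tnth_nth 0%N) ji; apply: h2; rewrite size_elements -ji.
Qed.

Lemma interleaved_mdist x y : interleaved (elements x) (elements y) -> mdist x y <= 1.
Proof.
move=> /interlacedP xy; rewrite interlaced_mdistE.
have [->|neq] := eqVneq x y.
  by rewrite (graph_distxx R (@interlaced_adj_connected R k)).
apply: (@graph_dist_le R _ (@interlaced_adj R k) x y [:: y]) => //=.
by rewrite andbT /interlaced_adj neq xy orbT.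
Qed.

Lemma count_path c x (s : seq (interlaced_graph R k)) :
  path (@interlaced_adj R k) x s ->
  (count (fun n => n < c)%N (elements x) <=
   count (fun n => n < c)%N (elements (last x s)) + size s)%N.
Proof.
elim: s x => [|y s ih] x /=; first by rewrite addn0.
move=> /andP[/andP[_ xy] /ih ys]; apply: (@leq_trans (count (fun n => n < c)%N (elements y)).+1).
  by case/orP: xy => /interlacedP/(interleaved_count c)[h1 h2] //; exact: leqW.
by rewrite addnS ltnS.
Qed.

Lemma count_mdist c x y (r : nat) :
  (count (fun n => n < c)%N (elements y) + r <= count (fun n => n < c)%N (elements x))%N ->
  r%:R <= mdist x y.
Proof.
move=> h; rewrite interlaced_mdistE.
have [s [ps ls ->]] := graph_dist_attained R (@interlaced_adj_connected R k) x y.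
rewrite ler_nat -(leq_add2l (count (fun n => n < c)%N (elements y))).
by apply: (leq_trans h); have := count_path c ps; rewrite ls.
Qed.

(** A vertex is moved in k steps to an interval beyond it, dropping its least
    element and appending a new greatest one at each step. Two vertices reach
    the same interval. *)
Lemma bounded_of_interleaved (W : normedModType R) (f : interlaced_graph R k -> W) (om : R) :
  0 <= om ->
  (forall x y, interleaved (elements x) (elements y) -> `|f x - f y| <= om) ->
  exists B, forall x, `|f x| <= B.
Proof.
move=> om0 hf.
have chain m c x : (m <= k)%N -> all (fun n => (n < c)%N) (elements x) ->
    exists2 y, elements y = drop m (elements x) ++ iota c m & `|f x - f y| <= m%:R * om.
  elim: m => [|m ih] mk xc.
    by exists x; rewrite ?drop0 ?cats0// subrr normr0 mul0r.
  have [y yE xy] := ih (ltnW mk) xc.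
  have ya : all (fun n => (n < c + m)%N) (elements y).
    rewrite yE all_cat; apply/andP; split; apply/allP => n.
      by move=> /mem_drop/(allP xc) nc; rewrite (leq_trans nc)// leq_addr.
    by rewrite mem_iota => /andP[].
  have y0 : (0 < size (elements y))%N by rewrite size_elements (leq_ltn_trans _ mk).
  have sh := interleaved_shift (elements_sorted y) ya y0.
  have zE : rcons (behead (elements y)) (c + m) = drop m.+1 (elements x) ++ iota c m.+1.
    rewrite yE -{2}addn1 iotaD/= -cats1 catA; congr (_ ++ _).
    have : (m < size (elements x))%N by rewrite size_elements.
    by move=> mx; rewrite (drop_nth 0%N mx).
  have [z zP] : exists z, elements z = rcons (behead (elements y)) (c + m).
    apply: elements_surj.
      case: (elements y) (elements_sorted y) ya => [|a t]//= st /andP[ac tc].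
      case: t st tc => [|b t]//= /andP[_ bt] tc.
      by rewrite rcons_path bt/=; apply: (@allP _ _ (b :: t) tc); exact: mem_last.
    by rewrite size_rcons size_behead prednK// size_elements.
  exists z; first by rewrite zP zE.
  have yz : `|f y - f z| <= om by apply: hf; rewrite zP.
  rewrite -natr1 mulrDl mul1r -(subrK (f y) (f x)) -addrA.
  by rewrite (le_trans (ler_normD _ _))// lerD.
have [x0 _] : exists x0, elements x0 = iota 0 k.
  by apply: elements_surj; [exact: iota_ltn_sorted|rewrite size_iota].
exists (k%:R * om + k%:R * om + `|f x0|) => x.
have [c] := seq_ub (elements x ++ elements x0); rewrite all_cat => /andP[xc x0c].
have [y yE xy] := chain k c x (leqnn k) xc.
have [y' y'E x0y'] := chain k c x0 (leqnn k) x0c.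
have yy : y' = y.
  by apply: elements_inj; rewrite yE y'E !drop_oversize ?size_elements.
rewrite yy in x0y'.
have -> : f x = (f x - f y) - (f x0 - f y) + f x0.
  by rewrite opprB addrA subrK subrK.
rewrite (le_trans (ler_normD _ _))// lerD2r.
by rewrite (le_trans (ler_normB _ _))// lerD.
Qed.

Lemma extend_to_seq (W : normedModType R) (f : interlaced_graph R k -> W) (B : R) :
  (forall x, `|f x| <= B) -> exists F : seq nat -> W,
    (forall s, `|F s| <= B) /\ (forall x, F (elements x) = f x).
Proof.
move=> fB; have [x0 _] : exists x0, elements x0 = iota 0 k.
  by apply: elements_surj; [exact: iota_ltn_sorted|rewrite size_iota].
exists (fun s => f (xget x0 [set x | elements x = s])); split=> [s|x]; first exact: fB.
congr f; case: xgetP => [y _ /elements_inj //|/(_ x)].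
by case.
Qed.

End graph.

Unset Implicit Arguments.

Theorem theorem4p1 (R : realType) (X : completeNormedModType R) (p q : R)
    (hX : quasi_reflexive X) (hp : 1 < p) (hpq : p^-1 + q^-1 = 1)
    (hXp : p_AUS_renormable X p) (hXq : p_AUS_renormable (dual X) q) :
  ~ equi_coarsely_embeds (fun k : nat => interlaced_graph R k.+1)
      (dual (dual X)).
Proof.
move=> [rho [omega [f [ro rho_oo moduli]]]].
have om0 : 0 <= omega 1 by exact: (ro 1 ler01).2.
have [G hG] := nonconcentration hX hp hpq hXp hXq om0.
have [r r0 Gr] : exists2 r : nat, (0 < r)%N & G < rho r%:R.
  have [A [_ AP]] := (cvgryPgt _).1 rho_oo G.
  exists (Num.trunc A).+1 => //; apply: AP; exact: truncnS_gt.
have [[//|k] _ hk] := hG r r0.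
have expand x y : mdist x y <= 1 -> `|f k x - f k y| <= omega 1.
  move=> xy; have [_] := moduli k 1 ler01; rewrite ge_max => /andP[_ h].
  rewrite -lee_fin -dual_mdistE; apply: le_trans h.
  by apply: ereal_sup_ubound; exists (x, y).
have edge x y : interleaved (elements x) (elements y) -> `|f k x - f k y| <= omega 1.
  by move=> xy; apply: expand; exact: interleaved_mdist.
have [B fB] := bounded_of_interleaved om0 edge.
have [F [FB Ff]] := extend_to_seq fB.
have [|u [v [c [su sv uk vk [small count]]]]] := hk F B FB.
  move=> u v su sv uk uv; have vk : size v = k.+1 by case: uv => <-.
  have [x xu] := elements_surj R su uk; have [y yv] := elements_surj R sv vk.
  by rewrite -xu -yv !Ff; apply: edge; rewrite xu yv.
have [x xu] := elements_surj R su uk; have [y yv] := elements_surj R sv vk.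
rewrite -xu -yv !Ff in small; rewrite -xu -yv in count.
have [+ _] := moduli k r%:R (ler0n _ r).
apply/negP; rewrite -ltNge; apply: (@le_lt_trans _ _ (G%:E)); last by rewrite lte_fin.
apply: (@le_trans _ _ (mdist (f k x) (f k y))%:E).
  by apply: ereal_inf_lbound; exists (x, y) => //=; exact: count_mdist count.
by rewrite lee_fin dual_mdistE.
Qed.
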